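(* Let $N\in\mathbb{N}$, $N\ge 1$, $\alpha\in(0,N)$ and $V\in L^\infty(\mathbb{R}^N)$. If $$\limsup_{|x|\to\infty}V(x)\le 1,$$ then $c_*\le c_\infty$. If in addition $c_*=c_\infty$, then there exists a minimizing sequence for $c_*$ which converges weakly to $0$ in $H^1(\mathbb{R}^N)$.
   Context: All functions are real-valued. $I_\alpha:\mathbb{R}^N\setminus\{0\}\to\mathbb{R}$ is the Riesz potential of order $\alpha\in(0,N)$, $$I_\alpha(x)=\frac{\Gamma(\frac{N-\alpha}{2})}{2^{\alpha}\pi^{N/2}\Gamma(\frac{\alpha}{2})\,|x|^{N-\alpha}} .$$ For $u\in L^2(\mathbb{R}^N)$ put $$D(u)=\int_{\mathbb{R}^N}\bigl(I_\alpha*|u|^{\frac{\alpha}{N}+1}\bigr)|u|^{\frac{\alpha}{N}+1},$$ which is finite by the Hardy-Littlewood-Sobolev inequality. Define $$c_\infty=\inf\Bigl\{\int_{\mathbb{R}^N}|u|^2 : u\in L^2(\mathbb{R}^N),\ D(u)=1\Bigr\}>0,$$ $$c_*=\inf\Bigl\{\int_{\mathbb{R}^N}|\nabla u|^2+V|u|^2 : u\in H^1(\mathbb{R}^N),\ D(u)=1\Bigr\}.$$ A minimizing sequence for $c_*$ is a sequence $(u_n)$ in $H^1(\mathbb{R}^N)$ with $D(u_n)=1$ for all $n$ and $\int_{\mathbb{R}^N}|\nabla u_n|^2+V|u_n|^2\to c_*$. Since $V$ is defined almost everywhere, $\limsup_{|x|\to\infty}$ is understood in the essential sense. *)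

(* Defs.v *)
From HB Require Import structures.
From mathcomp Require Import all_boot all_order all_algebra.
From mathcomp Require Import all_classical all_reals all_analysis ess_sup_inf.
Set Implicit Arguments.
Unset Strict Implicit.
Unset Printing Implicit Defensive.
Import Order.TTheory GRing.Theory Num.Theory.
Import numFieldNormedType.Exports.
Local Open Scope classical_set_scope.
Local Open Scope ring_scope.

(* The space R^N is 'rV[R]_N, whose library norm is the sup
   norm: the Euclidean norm is [enorm] below.  The library has no sigma-algebra
   and no Lebesgue measure on 'rV[R]_N; both are built first.  Elements of
   L^p are represented by Borel functions (every Lebesgue measurable function
   is a.e. equal to one); nothing below depends on the representative. *)

Definition rV_display : measure_display.
Proof. exact: default_measure_display. Qed.

Section rV_measurable.
Context {R : realType}.
Variable n : nat.

(* The coordinates generate the Borel sigma-algebra of R^n. *)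
Let coords : 'I_n -> 'rV[R]_n -> measurableTypeR R := fun i x => x 0 i.

Let rV_set0 : g_sigma_preimage coords set0.
Proof. exact: sigma_algebra0. Qed.

Let rV_setC A : g_sigma_preimage coords A -> g_sigma_preimage coords (~` A).
Proof. exact: sigma_algebraC. Qed.

Let rV_bigcup (F : _^nat) : (forall i, g_sigma_preimage coords (F i)) ->
  g_sigma_preimage coords (\bigcup_i (F i)).
Proof. exact: sigma_algebra_bigcup. Qed.

HB.instance Definition _ := @isMeasurable.Build rV_display
  'rV[R]_n (g_sigma_preimage coords) rV_set0 rV_setC rV_bigcup.

Lemma measurable_coord (i : 'I_n) :
  measurable_fun [set: 'rV[R]_n] (fun x => x 0 i : measurableTypeR R).
Proof.
move=> _ Y mY; rewrite setTI; apply: sub_sigma_algebra => /=.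
rewrite -bigcup_seq/=; exists i => /=; first by rewrite mem_index_enum.
by exists Y => //; rewrite setTI.
Qed.

Lemma measurable_fun_rV d (T : measurableType d) (f : T -> 'rV[R]_n) :
  (forall i, measurable_fun [set: T] (fun x => f x 0 i : measurableTypeR R)) ->
  measurable_fun [set: T] f.
Proof.
move=> mf _ A mA; rewrite setTI.
suff : g_sigma_preimage (fun i => coords i \o f) `<=` measurable.
  rewrite g_sigma_preimage_comp; apply.
  by exists A => //; rewrite setTI.
apply: smallest_sub; first exact: sigma_algebra_measurable.
move=> B; rewrite -bigcup_seq/= => -[i _ [C mC <-]].
exact: mf.
Qed.

End rV_measurable.

Section lebesgue_step.
Context {R : realType} (n : nat).

Definition row_cons (p : measurableTypeR R * 'rV[R]_n) : 'rV[R]_n.+1 :=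
  \row_i (if unlift ord0 i is Some j then p.2 0 j else p.1).

Definition row_tail (x : 'rV[R]_n.+1) : 'rV[R]_n := \row_i x 0 (lift ord0 i).

Lemma row_cons0 p : row_cons p 0 ord0 = p.1.
Proof. by rewrite mxE unlift_none. Qed.

Lemma row_consS p i : row_cons p 0 (lift ord0 i) = p.2 0 i.
Proof. by rewrite mxE liftK. Qed.

Lemma row_cons_tail (x : 'rV[R]_n.+1) : row_cons (x 0 ord0, row_tail x) = x.
Proof.
apply/rowP => i; have [j ->|->] := unliftP ord0 i.
  by rewrite row_consS mxE.
by rewrite row_cons0.
Qed.

Lemma measurable_row_cons : measurable_fun setT row_cons.
Proof.
apply: measurable_fun_rV => i; have [j ->|->] := unliftP ord0 i.
  under eq_fun do rewrite row_consS.
  exact: (measurableT_comp (@measurable_coord R n j) measurable_snd).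
under eq_fun do rewrite row_cons0.
exact: measurable_fst.
Qed.

Lemma measurable_row_tail : measurable_fun setT row_tail.
Proof.
apply: measurable_fun_rV => i; under eq_fun do rewrite mxE.
exact: measurable_coord.
Qed.

Definition lebesgue_step (m : set 'rV[R]_n -> \bar R) :
    set 'rV[R]_n.+1 -> \bar R :=
  pushforward (lebesgue_measure \x m)%E row_cons.

Variable m : {sigma_finite_measure set 'rV[R]_n -> \bar R}.

Let step0 : lebesgue_step m set0 = 0%E.
Proof. by rewrite /lebesgue_step /pushforward preimage_set0 measure0. Qed.

Let step_ge0 A : (0 <= lebesgue_step m A)%E.
Proof. exact: (measure_ge0 (lebesgue_measure \x m)%E). Qed.

Let step_sigma_additive : semi_sigma_additive (lebesgue_step m).
Proof.
move=> F mF tF mUF; rewrite /lebesgue_step /pushforward preimage_bigcup.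
apply: measure_semi_sigma_additive.
- by move=> k; rewrite -[X in measurable X]setTI; exact: measurable_row_cons.
- apply/trivIsetP => /= i j _ _ ij; rewrite -preimage_setI.
  by move/trivIsetP : tF => /(_ _ _ _ _ ij) ->//; rewrite preimage_set0.
- rewrite -preimage_bigcup -[X in measurable X]setTI.
  exact: measurable_row_cons.
Qed.

HB.instance Definition _ := isMeasure.Build _ _ _ (lebesgue_step m)
  step0 step_ge0 step_sigma_additive.

Let step_sigma_finite : sigma_finite setT (lebesgue_step m).
Proof.
have /sigma_finiteP[F [FT ndF Foo]] := sigma_finiteT (@lebesgue_measure R).
have /sigma_finiteP[G [GT ndG Goo]] := sigma_finiteT m.
have mFG k : measurable [set x : 'rV[R]_n.+1 | F k (x 0 ord0) /\ G k (row_tail x)].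
  apply: measurableI.
    rewrite -[X in measurable X]setTI.
    exact: (@measurable_coord R n.+1 ord0 measurableT _ (Foo k).1).
  rewrite -[X in measurable X]setTI.
  exact: (measurable_row_tail measurableT (Goo k).1).
exists (fun k => [set x : 'rV[R]_n.+1 | F k (x 0 ord0) /\ G k (row_tail x)]).
  rewrite predeqE => x; split => // _.
  have [i _ Fi] : (\bigcup_k F k) (x 0 ord0) by rewrite -FT.
  have [j _ Gj] : (\bigcup_k G k) (row_tail x) by rewrite -GT.
  exists (maxn i j) => //; split.
    by move: Fi; exact/subsetPset/ndF/leq_maxl.
  by move: Gj; exact/subsetPset/ndG/leq_maxr.
move=> k; have [mFk Fk] := Foo k; have [mGk Gk] := Goo k.
split; first exact: mFG.
rewrite /lebesgue_step /pushforward [X in product_measure1 _ _ X](_ : _ = F k `*` G k).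
  by rewrite product_measure1E// lte_mul_pinfty// ge0_fin_numE.
apply/seteqP; split=> -[a y] /=; rewrite row_cons0 (_ : row_tail _ = y)//;
  by apply/rowP => i; rewrite mxE row_consS.
Qed.

HB.instance Definition _ := Measure_isSigmaFinite.Build _ _ _ (lebesgue_step m)
  step_sigma_finite.

End lebesgue_step.

(* N-dimensional Lebesgue measure, as the N-fold product of the Lebesgue
   measure of R. *)
Fixpoint lebesgueN (R : realType) (n : nat) :
    {sigma_finite_measure set 'rV[R]_n -> \bar R} :=
  match n with
  | 0 => \d_(0 : 'rV[R]_0)
  | k.+1 => lebesgue_step (lebesgueN R k)
  end.

Lemma lebesgueN_box (R : realType) (n : nat) (A : 'I_n -> set (measurableTypeR R)) :
  (forall i, measurable (A i)) ->
  lebesgueN R n [set x | forall i, A i (x 0 i)] =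
  (\prod_(i < n) lebesgue_measure (A i))%E.
Proof.
elim: n => [|n IH] in A *; move=> mA.
  rewrite big_ord0/= diracE mem_set// => -[]//.
have mB : measurable [set x : 'rV[R]_n | forall i, A (lift ord0 i) (x 0 i)].
  have -> : [set x : 'rV[R]_n | forall i, A (lift ord0 i) (x 0 i)] =
      \bigcap_(i in [set: 'I_n]) ((fun x => x 0 i) @^-1` A (lift ord0 i)).
    by apply/seteqP; split => x h i; [move=> _|]; exact: h.
  apply: fin_bigcap_measurable => // i _.
  rewrite -[X in measurable X]setTI.
  exact: (@measurable_coord R n i measurableT _ (mA _)).
rewrite big_ord_recl -(IH (fun i => A (lift ord0 i))); last by move=> i; exact: mA.
rewrite -(product_measure1E lebesgue_measure (lebesgueN R n) (mA ord0) mB).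
rewrite /= /lebesgue_step /pushforward; congr (_ _).
apply/seteqP; split => -[a y] /=.
  move=> h; split; first by have := h ord0; rewrite row_cons0.
  by move=> i; have := h (lift ord0 i); rewrite row_consS.
move=> [ha hy] i; have [j ->|->] := unliftP ord0 i.
  by rewrite row_consS; exact: hy.
by rewrite row_cons0.
Qed.

Section choquard.
Context {R : realType} {N : nat}.
Local Notation E := 'rV[R]_N.
Local Notation mu := (lebesgueN R N).
Implicit Types (u v f V phi : E -> R) (g : E -> E) (alpha : R).

Definition enorm (x : E) : R := Num.sqrt (\sum_i x 0 i ^+ 2).

Definition Gamma (s : R) : R :=
  \int[lebesgue_measure]_(t in `]0, +oo[) (t `^ (s - 1) * expR (- t)).

(* At x = 0 this takes the irrelevant value 0. *)
Definition riesz alpha (x : E) : R :=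
  Gamma ((N%:R - alpha) / 2) /
  (2 `^ alpha * pi `^ (N%:R / 2) * Gamma (alpha / 2)
   * enorm x `^ (N%:R - alpha)).

Definition convolution (k f : E -> R) (x : E) : \bar R :=
  (\int[mu]_y (k (x - y) * f y)%:E)%E.

Definition choquard alpha u : \bar R :=
  let w := fun x => `|u x| `^ (alpha / N%:R + 1) in
  (\int[mu]_x (convolution (riesz alpha) w x * (w x)%:E))%E.

Definition basis (i : 'I_N) : E := delta_mx 0 i.

Definition iter_partial (s : seq 'I_N) phi : E -> R :=
  foldr (fun i f x => 'D_(basis i) f x) phi s.

(* C^oo with compact support *)
Definition test_function phi : Prop :=
  [/\ forall s, continuous (iter_partial s phi),
      forall s i x, derivable (iter_partial s phi) x (basis i)
    & compact (closure [set x | phi x != 0])].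

Definition L2 u : Prop := u \in Lfun mu 2%:E.

Definition weak_gradient u g : Prop :=
  forall phi (i : 'I_N), test_function phi ->
    \int[mu]_x (u x * 'D_(basis i) phi x) = - \int[mu]_x (g x 0 i * phi x).

(* u is in H^1 and g is (a representative of) its weak gradient, which is
   unique up to a.e. equality. *)
Definition H1_grad u g : Prop :=
  [/\ L2 u, forall i, L2 (fun x => g x 0 i) & weak_gradient u g].

Definition H1 u : Prop := exists g, H1_grad u g.

(* The quadratic functional, evaluated at u with weak gradient g. *)
Definition energy V u g : \bar R :=
  (\int[mu]_x (enorm (g x) ^+ 2 + V x * `|u x| ^+ 2)%:E)%E.

(* The infima are taken in the extended reals: c_star may be -oo. *)
Definition c_infty alpha : \bar R :=
  ereal_inf [set e | exists u,
    [/\ L2 u, choquard alpha u = 1%E & e = (\int[mu]_x (`|u x| ^+ 2)%:E)%E]].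

Definition c_star alpha V : \bar R :=
  ereal_inf [set e | exists u g,
    [/\ H1_grad u g, choquard alpha u = 1%E & e = energy V u g]].

Definition minimizing_sequence alpha V (u : nat -> E -> R) : Prop :=
  exists g : nat -> E -> E,
    [/\ forall n, H1_grad (u n) (g n),
        forall n, choquard alpha (u n) = 1%E
      & energy V (u n) (g n) @[n --> \oo] --> c_star alpha V].

(* Continuous linear functionals on H^1, as functions of representatives;
   boundedness forces them to respect a.e. equality.  [energy (cst 1) u g] is
   the square of the H^1 norm of u. *)
Definition H1_dual (l : (E -> R) -> R) : Prop :=
  (forall a u v, H1 u -> H1 v ->
     l (fun x => a * u x + v x) = a * l u + l v) /\
  (exists C : R, forall u g, H1_grad u g ->
     `|l u| <= C * Num.sqrt (fine (energy (cst 1) u g))).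

Definition H1_weak_cvg (u : nat -> E -> R) v : Prop :=
  forall l, H1_dual l -> l (u n) @[n --> \oo] --> l v.

Definition ess_limsup_infty V : \bar R :=
  ereal_inf (range (fun r : R =>
    ess_sup mu (fun x => if r < enorm x then (V x)%:E else -oo%E))).

End choquard.

Arguments c_infty {R} N alpha.

(* Main.v *)
Require Import Defs.
From HB Require Import structures.
From mathcomp Require Import all_boot all_order all_algebra.
From mathcomp Require Import all_classical all_reals all_analysis.
From mathcomp Require Import measurable_realfun ess_sup_inf ring lra.
Set Implicit Arguments.
Unset Strict Implicit.
Unset Printing Implicit Defensive.
Import Order.TTheory GRing.Theory Num.Theory.
Import numFieldNormedType.Exports.
Local Open Scope classical_set_scope.
Local Open Scope ring_scope.

(* By density, [c_infty] is approached by functions [v] that are bounded, have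
   compact support and have a bounded weak gradient: truncate a competitor, then
   average it over short segments in each coordinate direction.  Each averaging
   creates one weak derivative, a difference quotient; by Fatou's lemma it does
   not decrease [choquard] much, by dominated convergence it does not increase
   the L^2 norm much.  The dilations [t `^ (N / 2) * v (t x)] leave both
   [choquard] and the L^2 norm unchanged and multiply the Dirichlet energy by
   [t ^ 2], which can thus be made negligible.  Translating the result to where
   [V <= 1 + e] gives competitors for [c_star] of energy close to [c_infty].
   When [c_star = c_infty], a sequence of such translates is minimizing; taking
   their supports pairwise disjoint makes them orthogonal and bounded in H^1, and
   Bessel's inequality then gives weak convergence to 0. *)

(** * Integration on R^N *)

(** Only one-sided control of the Choquard term is ever used. Fatou's lemma makes it lower
    semicontinuous under a.e. convergence, and the small deficit is repaired by a constant factor,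
    the functional being homogeneous of degree [2 * (alpha / N + 1)]. Finiteness is then needed only
    on bounded functions of bounded support, where local integrability of the Riesz potential
    replaces the Hardy-Littlewood-Sobolev inequality. Averages along segments take the place of
    mollifiers: their a.e. convergence comes from Lebesgue differentiation on the line, their weak
    derivative is explicit, and averaging in a further direction keeps the derivatives already
    obtained. The exponent [alpha / N + 1] is exactly the one for which the dilations preserving the
    L^2 norm also preserve the Choquard term, which is why a gradient costs nothing in the limit.
    Weak derivatives are tested against all C^1 functions, a class stable under affine changes of
    variables. Supports are separated in a single coordinate. *)

Section lebesgueN_change_of_variables.
Context {R : realType}.

Lemma ge0_integral_lebesgueS n (f : 'rV[R]_n.+1 -> \bar R) :
  measurable_fun [set: 'rV[R]_n.+1] f -> (forall x, 0 <= f x)%E ->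
  (\int[lebesgueN R n.+1]_x f x =
   \int[lebesgue_measure]_a \int[lebesgueN R n]_y f (row_cons (a, y)))%E.
Proof.
move=> mf f0.
rewrite /= /lebesgue_step ge0_integral_pushforward//; last exact: measurable_row_cons.
rewrite preimage_setT fubini_tonelli1//.
- by apply: measurableT_comp => //; exact: measurable_row_cons.
- by move=> x; exact: f0.
Qed.

Lemma measurable_affine n (s : R) (b : 'rV[R]_n) :
  measurable_fun [set: 'rV[R]_n] (fun x => s *: x + b).
Proof.
apply: measurable_fun_rV => i; under eq_fun do rewrite !mxE.
apply: measurable_funD => //; apply: measurable_funM => //.
exact: measurable_coord.
Qed.

Local Notation mR := (measurableTypeR R).

Let measurable_affine1 (s b : R) : measurable_fun [set: mR] (fun t : mR => s * t + b : mR).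
Proof. by apply: measurable_funD => //; exact: measurable_funM. Qed.

Let affine_measure (s b : R) : {measure set mR -> \bar R} :=
  measure_function_pushforward__canonical__measure_function_Measure
    lebesgue_measure (measurable_affine1 s b).

(** By uniqueness of Lebesgue measure it suffices to compare on half-open intervals; as [0 < s], the
    preimage of such an interval is again one of the same kind. *)
Lemma lebesgue_measure_affine (s b : R) (s0 : 0 < s) (A : set mR) :
  measurable A ->
  (lebesgue_measure A = s%:E * lebesgue_measure ((fun t => s * t + b)%R @^-1` A))%E.
Proof.
apply: (@lebesgue_measure_unique R (mscale (NngNum (ltW s0)) (affine_measure s b))).
move=> _ [[x y] _ <-] /=.
rewrite /mscale/= /pushforward.
have -> : (fun t : mR => (s * t + b)%R) @^-1` `]x, y] = `](x - b) / s, (y - b) / s]%classic.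
  by apply/seteqP; split => t /=; rewrite !in_itv/= ltr_pdivrMr// ler_pdivlMr//
    [t * s]mulrC ltrBlDr lerBrDr.
rewrite !lebesgue_measure_itv/= !lte_fin ltr_pM2r ?invr_gt0// ltrD2r.
case: ifPn => xy; last by rewrite mule0.
rewrite -!EFinB -EFinM; congr EFin.
by field; rewrite gt_eqF.
Qed.

Lemma ge0_integral_affine1 (s b : R) (f : R -> \bar R) : 0 < s ->
  measurable_fun [set: R] f -> (forall x, 0 <= f x)%E ->
  (s%:E * \int[lebesgue_measure]_x f (s * x + b)%R =
   \int[lebesgue_measure]_x f x)%E.
Proof.
move=> s0 mf f0.
rewrite [RHS](@eq_measure_integral _ _ _ _
  (mscale (NngNum (ltW s0)) (affine_measure s b))); last first.
  by move=> A mA _; exact: lebesgue_measure_affine.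
rewrite ge0_integral_mscale//=; congr (_ * _)%E.
rewrite ge0_integral_pushforward//; exact: measurable_affine1.
Qed.

Lemma measurable_integral_row_cons n (f : 'rV[R]_n.+1 -> \bar R) :
  measurable_fun [set: 'rV[R]_n.+1] f -> (forall x, 0 <= f x)%E ->
  measurable_fun [set: R] (fun a => \int[lebesgueN R n]_y f (row_cons (a, y)))%E.
Proof.
move=> mf f0.
apply: (@measurable_fun_fubini_tonelli_F _ _ _ _ _ (lebesgueN R n) (fun z => f (row_cons z))).
- by apply: measurableT_comp => //; exact: measurable_row_cons.
- by move=> x; exact: f0.
Qed.

Lemma ge0_integral_affine n (s : R) (b : 'rV[R]_n) (f : 'rV[R]_n -> \bar R) :
  0 < s -> measurable_fun [set: 'rV[R]_n] f -> (forall x, 0 <= f x)%E ->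
  ((s ^+ n)%:E * \int[lebesgueN R n]_x f (s *: x + b)%R =
   \int[lebesgueN R n]_x f x)%E.
Proof.
elim: n b f => [|n IH] b f s0 mf f0.
  rewrite expr0 mul1e; apply: eq_integral => x _.
  by congr f; apply/rowP => -[].
rewrite !ge0_integral_lebesgueS//; last first.
  apply: measurableT_comp => //; exact: measurable_affine.
pose G a := (\int[lebesgueN R n]_y f (row_cons (a, y)))%E.
have mG : measurable_fun [set: R] G by exact: measurable_integral_row_cons.
have G0 x : (0 <= G x)%E by exact: integral_ge0.
(* The induction hypothesis, with translation vector [row_tail b], treats all coordinates but the
   first; what remains is an affine substitution on the line. *)
have E a : (\int[lebesgueN R n]_y f (s *: row_cons (a, y) + b)%R =
    ((s ^+ n)^-1)%:E * G (s * a + b 0 ord0)%R)%E.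
  rewrite /G -[in RHS](IH (row_tail b))//; last first.
    apply: measurableT_comp => //. apply: measurableT_comp.
      exact: measurable_row_cons.
    exact: measurable_pair1.
  rewrite muleA -EFinM mulVf ?mul1e; last by rewrite expf_neq0// gt_eqF.
  apply: eq_integral => y _; congr f; apply/rowP => i.
  have [j ->|->] := unliftP ord0 i.
    by rewrite !mxE liftK/= !mxE.
  by rewrite !mxE unlift_none.
under eq_integral do rewrite E.
rewrite ge0_integralZl_EFin//; last 2 first.
- apply: measurableT_comp => //; exact: measurable_affine1.
- by rewrite invr_ge0 exprn_ge0// ltW.
rewrite muleA -EFinM exprS -mulrA mulfV ?mulr1; last by rewrite expf_neq0// gt_eqF.
exact: ge0_integral_affine1.
Qed.

Lemma ge0_integral_affineV n (s : R) (b : 'rV[R]_n) (f : 'rV[R]_n -> \bar R) :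
  0 < s -> measurable_fun [set: 'rV[R]_n] f -> (forall x, 0 <= f x)%E ->
  (\int[lebesgueN R n]_x f (s *: x + b)%R =
   ((s ^+ n)^-1)%:E * \int[lebesgueN R n]_x f x)%E.
Proof.
move=> s0 mf f0; rewrite -(ge0_integral_affine b s0 mf f0) muleA -EFinM.
by rewrite mulVf ?mul1e// expf_neq0// gt_eqF.
Qed.

Lemma integral_translate1 (f : R -> \bar R) (b : R) : measurable_fun [set: R] f ->
  (\int[lebesgue_measure]_x f (x + b)%R = \int[lebesgue_measure]_x f x)%E.
Proof.
move=> mf; rewrite integralE [RHS]integralE.
rewrite -(@ge0_integral_affine1 1 b f^\+%E)//; last exact: measurable_funepos.
rewrite -(@ge0_integral_affine1 1 b f^\-%E)//; last exact: measurable_funeneg.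
rewrite !mul1e; congr (_ - _)%E; apply: eq_integral => x _.
- by rewrite !funeposE mul1r.
- by rewrite !funenegE mul1r.
Qed.

Lemma integral_translate n (f : 'rV[R]_n -> \bar R) (b : 'rV[R]_n) :
  measurable_fun [set: 'rV[R]_n] f ->
  (\int[lebesgueN R n]_x f (x + b)%R = \int[lebesgueN R n]_x f x)%E.
Proof.
move=> mf; rewrite integralE [RHS]integralE.
rewrite -(@ge0_integral_affine n 1 b f^\+%E)//; last exact: measurable_funepos.
rewrite -(@ge0_integral_affine n 1 b f^\-%E)//; last exact: measurable_funeneg.
rewrite expr1n !mul1e; congr (_ - _)%E; apply: eq_integral => x _.
- by rewrite !funeposE scale1r.
- by rewrite !funenegE scale1r.
Qed.

End lebesgueN_change_of_variables.

Section measurability_rV.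
Context {R : realType} {n : nat}.
Local Notation E := 'rV[R]_n.

Lemma rV_norm_le (x : E) (e : R) : 0 <= e ->
  (`|x| <= e) = [forall i, `|x 0 i| <= e].
Proof.
move=> e0; rewrite [`|x|]mx_normrE; apply/idP/forallP => [xe i|xe].
  by apply: le_trans xe; apply: (le_bigmax _ (fun ij => `|x ij.1 ij.2|) (0, i)).
by apply/bigmax_leP; split => // -[i j] _ /=; rewrite (ord1 i).
Qed.

Let grid (k : nat) (m : 'rV[int]_n) : E := \row_i ((m 0 i)%:~R / k.+1%:R).
Let gridfloor (k : nat) (x : E) : 'rV[int]_n :=
  \row_i Num.floor (x 0 i * k.+1%:R).

Let cvg_grid (x : E) : grid k (gridfloor k x) @[k --> \oo] --> x.
Proof.
apply/cvgrPdist_le => e e0.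
near=> k.
rewrite (rV_norm_le _ (ltW e0)); apply/forallP => i; rewrite !mxE.
have k0 : 0 < k.+1%:R :> R by [].
set y := x 0 i; have /andP[y1 y2] := floor_itv (y * k.+1%:R).
have -> : y - (Num.floor (y * k.+1%:R))%:~R / k.+1%:R =
          (y * k.+1%:R - (Num.floor (y * k.+1%:R))%:~R) / k.+1%:R.
  by field; rewrite gt_eqF.
rewrite ger0_norm; last by rewrite divr_ge0 ?subr_ge0// ltW.
rewrite (@le_trans _ _ k.+1%:R^-1)//.
  by rewrite ler_piMl ?invr_ge0 ?(ltW k0)// lerBlDl; apply/ltW; move: y2; rewrite intrD.
apply/ltW; near: k; exact: near_infty_natSinv_lt (PosNum e0).
Unshelve. all: by end_near. Qed.

(** The sigma-algebra is generated by the coordinates and not by open sets. So [f] is written as the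
    limit of step functions, constant on the cells of a cubic grid of mesh [1 / (k + 1)]. *)
Lemma continuous_measurable_rV (f : E -> R) : continuous f -> measurable_fun [set: E] f.
Proof.
move=> cf.
apply: (@measurable_fun_cvg _ _ _ setT (fun k x => f (grid k (gridfloor k x)))); last first.
  move=> x _; apply: continuous_cvg; [exact: cf|exact: cvg_grid].
move=> k _ Y mY; rewrite setTI.
(* There are countably many cells, indexed by integer vectors; the preimage is the union of those
   whose corner is sent into [Y]. *)
have -> : (fun x => f (grid k (gridfloor k x))) @^-1` Y =
    \bigcup_(m in [set: 'rV[int]_n]) (if `[< Y (f (grid k m)) >] then [set x | gridfloor k x = m] else set0).
  apply/seteqP; split => x /=.
    by move=> Yx; exists (gridfloor k x) => //; rewrite ifT//; exact/asboolP.
  by move=> [m _]; case: asboolP => // Ym /= ->.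
apply: countable_bigcupT_measurable; first exact: countableP.
move=> m; case: asboolP => // _.
have -> : [set x | gridfloor k x = m] =
    \bigcap_(i in [set: 'I_n]) ((fun x : E => x 0 i) @^-1`
      [set` `[(m 0 i)%:~R / k.+1%:R, (m 0 i + 1)%:~R / k.+1%:R[]).
  have k0 : 0 < k.+1%:R :> R by [].
  apply/seteqP; split => x /=.
    move=> <- i _ /=; rewrite in_itv/= !mxE.
    by rewrite ler_pdivrMr// ltr_pdivlMr//; exact: floor_itv.
  move=> h; apply/rowP => i; rewrite mxE; apply: floor_def.
  have := h i Logic.I; rewrite /= in_itv/= ler_pdivrMr// ltr_pdivlMr//.
apply: fin_bigcap_measurable => // i _.
rewrite -[X in measurable X]setTI.
exact: (@measurable_coord R n i).
Qed.

Lemma measurable_enorm : measurable_fun [set: E] (@enorm R n).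
Proof.
apply: (@measurableT_comp _ _ _ _ _ _ (@Num.sqrt R)).
  by apply: continuous_measurable_fun; exact: sqrt_continuous.
apply: measurable_sum => i; apply: measurable_funX; exact: measurable_coord.
Qed.

Lemma measurable_sub_rV : measurable_fun [set: E * E] (fun z => z.1 - z.2).
Proof.
apply: measurable_fun_rV => i; under eq_fun do rewrite !mxE.
apply: measurable_funB.
  exact: (measurableT_comp (@measurable_coord R n i) measurable_fst).
exact: (measurableT_comp (@measurable_coord R n i) measurable_snd).
Qed.

Lemma measurable_shift (b : E) : measurable_fun [set: E] (fun x => x + b).
Proof.
rewrite (_ : (fun x => x + b) = (fun x => 1 *: x + b)); first exact: measurable_affine.
by apply/funext => x; rewrite scale1r.
Qed.

Lemma measurable_line (b : E) :
  measurable_fun [set: E * measurableTypeR R] (fun z => z.1 + z.2 *: b).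
Proof.
apply: measurable_fun_rV => i; under eq_fun do rewrite !mxE.
apply: measurable_funD.
  exact: (measurableT_comp (@measurable_coord R n i) measurable_fst).
by apply: measurable_funM.
Qed.

End measurability_rV.

Section bounded_compact_support.
Context {R : realType} {n : nat}.
Local Notation E := 'rV[R]_n.
Local Notation mu := (lebesgueN R n).

Definition box (r : R) : set E := [set x | forall i, `|x 0 i| <= r].

Lemma box_sub (r s : R) : r <= s -> box r `<=` box s.
Proof. by move=> rs x xr i; exact: le_trans (xr i) rs. Qed.

Lemma measurable_rV_prod (A : 'I_n -> set (measurableTypeR R)) :
  (forall i, measurable (A i)) -> measurable [set x : E | forall i, A i (x 0 i)].
Proof.
move=> mA.
have -> : [set x : E | forall i, A i (x 0 i)] =
    \bigcap_(i in [set: 'I_n]) ((fun x : E => x 0 i) @^-1` A i).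
  by apply/seteqP; split => x h i; [move=> _|]; exact: h.
apply: fin_bigcap_measurable => // i _.
rewrite -[X in measurable X]setTI.
exact: (@measurable_coord R n i measurableT _ (mA i)).
Qed.

Lemma boxE (r : R) : box r = [set x : E | forall i, `[- r, r]%classic (x 0 i)].
Proof.
by apply/seteqP; split => x /= h i; have := h i; rewrite /= in_itv/= -ler_norml.
Qed.

Lemma measurable_box r : measurable (box r).
Proof.
by rewrite boxE; apply: (@measurable_rV_prod (fun=> `[- r, r]%classic)).
Qed.

Lemma lebesgueN_box_lty r : (mu (box r) < +oo)%E.
Proof.
rewrite boxE (lebesgueN_box (A := fun=> `[- r, r]%classic))//.
suff /andP[] : (0 <= \prod_(i < n) lebesgue_measure (`[(- r)%R, r]%classic : set R) < +oo)%E by [].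
apply: (@big_ind _ (fun x => 0 <= x < +oo)%E).
- by rewrite lee_fin ler01 ltry.
- move=> x y /andP[x0 x1] /andP[y0 y1]; rewrite mule_ge0//=.
  by rewrite lte_mul_pinfty// ge0_fin_numE.
- by move=> i _; rewrite measure_ge0 lebesgue_measure_itv/=; case: ifPn => //; rewrite -EFinB ltry.
Qed.

(** Bounded Borel functions of compact support, with one constant for the bound and the size of the
    support. Their products with locally bounded functions are integrable, which settles the
    integrability conditions of the later computations. *)
Definition bcs (f : E -> R) := measurable_fun [set: E] f /\
  exists B, (forall x, `|f x| <= B) /\ (forall x, f x != 0 -> box B x).

Definition locally_bounded_mfun (g : E -> R) := measurable_fun [set: E] g /\
  forall r, exists C, forall x, box r x -> `|g x| <= C.

Lemma bcsI (f : E -> R) (M r : R) : measurable_fun [set: E] f ->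
  (forall x, `|f x| <= M) -> (forall x, f x != 0 -> box r x) -> bcs f.
Proof.
move=> mf fM fr; split => //; exists (Num.max M r); split.
  by move=> x; rewrite le_max fM.
by move=> x /fr; apply: box_sub; rewrite le_max lexx orbT.
Qed.

Lemma bcs_measurable f : bcs f -> measurable_fun [set: E] f.
Proof. by case. Qed.

Lemma bcs_integrable f : bcs f -> mu.-integrable setT (EFin \o f).
Proof.
move=> [mf [B [fB fr]]].
have B0 : 0 <= B by exact: le_trans (fB 0).
have mb := measurable_box B.
apply: (@le_integrable _ _ _ _ _ measurableT _ (fun x => B%:E * (\1_(box B) x)%:E)%E).
- exact/measurable_EFinP.
- move=> x _ /=; rewrite lee_fin normrM (ger0_norm B0).
  have [fx0|/fr bx] := eqVneq (f x) 0; first by rewrite fx0 normr0 mulr_ge0.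
  by rewrite indicE mem_set// normr1 mulr1.
- apply: integrableZl => //.
  apply/integrableP; split; first by apply/measurable_EFinP; exact: measurable_indic.
  under eq_integral do rewrite gee0_abs ?lee_fin//.
  by rewrite integral_indic// setIT lebesgueN_box_lty.
Qed.

Lemma bcs_integralZl (a : R) (f : E -> R) : bcs f ->
  (\int[mu]_x (a * f x)%:E = a%:E * \int[mu]_x (f x)%:E)%E.
Proof. by move=> bf; rewrite -integralZl//; exact: bcs_integrable. Qed.

Lemma bcsM f g : bcs f -> locally_bounded_mfun g -> bcs (fun x => f x * g x).
Proof.
move=> [mf [B [fB fr]]] [mg /(_ B)[C gC]].
have B0 : 0 <= B by exact: le_trans (fB 0).
apply: (@bcsI _ (B * `|C|) B); first exact: measurable_funM.
- move=> x; have [fx0|/fr bx] := eqVneq (f x) 0; first by rewrite fx0 mul0r normr0 mulr_ge0.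
  by rewrite normrM ler_pM//; apply: le_trans (gC _ bx) (ler_norm _).
- by move=> x; rewrite mulf_eq0 negb_or => /andP[/fr].
Qed.

Lemma bcs_comp (h : R -> R) f : bcs f -> measurable_fun [set: R] h -> h 0 = 0 ->
  (forall B, exists C, forall t, `|t| <= B -> `|h t| <= C) -> bcs (h \o f).
Proof.
move=> [mf [B [fB fr]]] mh h0 /(_ B)[C hC].
apply: (@bcsI _ C B); first exact: measurableT_comp.
- by move=> x; exact: hC.
- by move=> x; have [fx0|/fr//] := eqVneq (f x) 0; rewrite /= fx0 h0 eqxx.
Qed.

Lemma bcsD f g : bcs f -> bcs g -> bcs (fun x => f x + g x).
Proof.
move=> [mf [B [fB fr]]] [mg [C [gC gr]]].
apply: (@bcsI _ (B + C) (Num.max B C)); first exact: measurable_funD.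
- by move=> x; exact: le_trans (ler_normD _ _) (lerD _ _).
- move=> x; have [fx0|/fr fx _] := eqVneq (f x) 0.
    by rewrite fx0 add0r => /gr; apply: box_sub; rewrite le_max lexx orbT.
  by apply: box_sub fx; rewrite le_max lexx.
Qed.

Lemma bcsZ a f : bcs f -> bcs (fun x => a * f x).
Proof.
move=> bf; apply: (@bcs_comp (fun t => a * t) f bf); first exact: measurable_funM.
  exact: mulr0.
move=> B; exists (`|a| * B) => t tB; rewrite normrM ler_wpM2l//.
Qed.

Lemma bcs0 : bcs (cst 0).
Proof.
by apply: (@bcsI _ 0 0) => // x; rewrite /= ?normr0 ?eqxx.
Qed.

Lemma bcs_indic_box (r : R) : bcs (\1_(box r) : E -> R).
Proof.
apply: (@bcsI _ 1 r).
- by apply: measurable_indic; exact: measurable_box.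
- by move=> x; rewrite ger0_norm// indicE lern1 leq_b1.
- by move=> x; rewrite indicE; case: (boolP (x \in _)) => [/set_mem//|_]; rewrite eqxx.
Qed.

Lemma bcs_affine s b f : s != 0 -> bcs f -> bcs (fun x => f (s *: x + b)).
Proof.
move=> s0 [mf [B [fB fr]]].
have mg : measurable_fun [set: E] (fun x => f (s *: x + b)).
  by apply: measurableT_comp => //; exact: measurable_affine.
apply: (@bcsI _ B ((B + `|b|) / `|s|)) => // x /fr h i.
rewrite ler_pdivlMr ?normr_gt0// mulrC -normrM.
have := h i; rewrite !mxE => h'.
rewrite -[s * _](addrK (b 0 i)); apply: le_trans (ler_normB _ _) (lerD h' _).
by have := rV_norm_le b (normr_ge0 b); rewrite lexx => /esym/forallP.
Qed.

Lemma bcs_locally_bounded f : bcs f -> locally_bounded_mfun f.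
Proof. by move=> [mf [B [fB _]]]; split => // r; exists B => x _. Qed.

Lemma continuous_locally_bounded f : continuous f -> locally_bounded_mfun f.
Proof.
move=> cf; split; first exact: continuous_measurable_rV.
move=> r.
have cbox : compact (box r).
  rewrite boxE; apply: (@rV_compact R n (fun=> [set` `[- r, r]])) => _.
  exact: segment_compact.
have : bounded_set (f @` box r).
  apply/compact_bounded/continuous_compact => //.
  exact: continuous_subspaceT.
move=> [M [_ h]]; exists (M + 1) => x xr.
by apply: (h (M + 1)); [rewrite ltrDl|exists x].
Qed.

End bounded_compact_support.

(** * The Riesz potential and the Choquard functional *)

Section Gamma_positive.
Context {R : realType}.
Local Notation leb := (@lebesgue_measure R).

Lemma integral_is_derive (f F : R -> R) (a b : R) : a < b ->
  (forall t, a <= t <= b -> is_derive t 1 F (f t)) ->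
  {within `[a, b], continuous f} ->
  (\int[leb]_(t in `[a, b]) (f t)%:E = (F b - F a)%:E)%E.
Proof.
move=> ab dF cf.
have cF t : a <= t <= b -> {for t, continuous F}.
  by move=> /dF dt; apply/differentiable_continuous/derivable1_diffP; exact: ex_derive.
rewrite (@continuous_FTC2 _ _ F)//.
- split.
  + move=> t; rewrite in_itv/= => /andP[/ltW ta /ltW tb].
    have := dF t; rewrite ta tb => /(_ isT) dt; exact: ex_derive.
  + by apply: cvg_at_right_filter; apply: cF; rewrite lexx ltW.
  + by apply: cvg_at_left_filter; apply: cF; rewrite lexx ltW.
- move=> t; rewrite in_itv/= => /andP[/ltW ta /ltW tb].
  have := dF t; rewrite ta tb => /(_ isT) dt.
  by rewrite derive1E; exact: derive_val.
Qed.

Lemma continuous_powR_gt0 (s t : R) : 0 < t -> {for t, continuous (fun x : R => x `^ s)}.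
Proof.
move=> t0; apply/differentiable_continuous/derivable1_diffP.
by apply: derivable_powR; rewrite in_itv/= t0.
Qed.

Lemma integral_powR_segment (s a r : R) : 0 < s -> 0 < a -> a < r ->
  (\int[leb]_(t in `[a, r]) (t `^ (s - 1))%:E = ((r `^ s - a `^ s) / s)%:E)%E.
Proof.
move=> s0 a0 ar.
have dF t : a <= t <= r -> is_derive t 1 (fun t => s^-1 * t `^ s) (t `^ (s - 1)).
  move=> /andP[ta _].
  have t0 : 0 < t by exact: lt_le_trans ta.
  have -> : t `^ (s - 1) = s^-1 *: (s * t `^ (s - 1)).
    by rewrite /GRing.scale/=; field; rewrite gt_eqF.
  have dp := is_derive1_powR s t0.
  exact: is_deriveZ.
rewrite (integral_is_derive ar dF).
- by rewrite -mulrBr mulrC.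
- apply: continuous_in_subspaceT => t; rewrite inE/= in_itv/= => /andP[ta _].
  by apply: continuous_powR_gt0; exact: lt_le_trans ta.
Qed.

Lemma integral_powR_lty (s r : R) : 0 < s -> 0 < r ->
  (\int[leb]_(t in `]0%R, r]) (t `^ (s - 1))%:E < +oo)%E.
Proof.
move=> s0 r0.
(* The exhaustion avoids 0, where the integrand blows up if [s < 1]; [k.+2] makes the left end
   strictly smaller than [r] already for [k = 0]. *)
pose F k := [set` `[r / k.+2%:R, r]] : set R.
have -> : [set` `]0%R, r]] = \bigcup_k F k.
  apply/seteqP; split => t /=; rewrite in_itv/=.
    move=> /andP[t0 tr].
    exists (Num.trunc (r / t)) => //; rewrite /F/= in_itv/= tr andbT.
    rewrite ler_pdivrMr// mulrC -ler_pdivrMr//.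
    have := truncnS_gt (r / t) => h.
    by apply: le_trans (ltW h) _; rewrite ler_nat.
  by move=> [k _]; rewrite /F/= in_itv/= => /andP[h ->]; rewrite andbT (lt_le_trans _ h)// divr_gt0.
have mp : measurable_fun [set: R] (fun t => (t `^ (s - 1))%:E).
  by apply/measurable_EFinP; exact: measurable_powR.
apply: (@le_lt_trans _ _ (r `^ s / s)%:E); last by rewrite ltry.
apply: (@cvge_to_le _ _ _ _ _ _ _ (@ge0_nondecreasing_set_cvg_integral _ (measurableTypeR R) R F (fun t => (t `^ (s - 1))%:E) leb _ _ _ _)).
- apply/nondecreasing_seqP => k; apply/subsetPset => t; rewrite /F/= !in_itv/= => /andP[h ->].
  rewrite andbT (le_trans _ h)// ler_wpM2l ?(ltW r0)// lef_pV2 ?posrE//.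
  by rewrite ler_nat.
- by move=> i; exact: measurable_itv.
- by move=> i; apply: measurable_funTS.
- by move=> i t _; rewrite lee_fin powR_ge0.
apply: nearW => k; rewrite /F integral_powR_segment//; last 2 first.
- by rewrite divr_gt0.
- by rewrite ltr_pdivrMr// ltr_pMr// ltr1n.
by rewrite lee_fin ler_wpM2r ?invr_ge0 ?(ltW s0)// gerBl powR_ge0.
Qed.

Let gammai (s t : R) := t `^ (s - 1) * expR (- t).

Let measurable_gammai s : measurable_fun [set: R] (EFin \o gammai s).
Proof.
apply/measurable_EFinP/measurable_funM; first exact: measurable_powR.
by apply: measurableT_comp => //; exact: measurable_funN.
Qed.

Let gammai_ge0 s t : 0 <= gammai s t.
Proof. by rewrite mulr_ge0 ?powR_ge0 ?expR_ge0. Qed.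

Let Gamma_lty s : 0 < s -> (\int[leb]_(t in `]0%R, +oo[) (gammai s t)%:E < +oo)%E.
Proof.
move=> s0.
have -> : `]0, +oo[%classic = `]0, 1]%classic `|` `]1, +oo[%classic :> set R.
  by rewrite -itv_bndbnd_setU// bnd_simp.
rewrite ge0_integral_setU//=; last 3 first.
- by apply: measurable_funTS; exact: measurable_gammai.
- by move=> t _; rewrite lee_fin gammai_ge0.
- apply/disj_setPRL => t /=; rewrite !in_itv/= andbT => t1.
  by apply/negP; rewrite negb_and -!ltNge t1 orbT.
apply: lte_add_pinfty.
  apply: le_lt_trans (integral_powR_lty s0 ltr01).
  apply: ge0_le_integral => //.
  - by move=> t _; rewrite lee_fin gammai_ge0.
  - by apply: measurable_funTS; exact: measurable_gammai.
  - by apply/measurable_EFinP/measurable_funTS; exact: measurable_powR.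
  - move=> t; rewrite /= in_itv/= => /andP[t0 _].
    by rewrite lee_fin /gammai ler_piMr ?powR_ge0// expR_le1 oppr_le0 ltW.
pose m := Num.trunc s.
pose C := m.+1`!%:R * 2 ^+ m.+1 : R.
have C0 : 0 <= C by rewrite mulr_ge0// exprn_ge0.
have half : 0 < 2^-1 :> R by rewrite invr_gt0.
apply: (@le_lt_trans _ _ (\int[leb]_t ((2 * C)%:E * (exponential_pdf 2^-1 t)%:E))%E); last first.
  rewrite ge0_integralZl_EFin//.
  - by rewrite integral_exponential_pdf// mule1 ltry.
  - by move=> t _; rewrite lee_fin exponential_pdf_ge0// ltW.
  - by apply/measurable_EFinP; exact: measurable_exponential_pdf.
  - by rewrite mulr_ge0.
rewrite integral_mkcond.
apply: ge0_le_integral => //.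
- by move=> t _; apply: erestrict_ge0 => x _; rewrite lee_fin gammai_ge0.
- by apply/(measurable_restrictT _ _).1 => //; by apply: measurable_funTS; exact: measurable_gammai.
- apply/measurable_EFinP/measurable_funM => //; exact: measurable_exponential_pdf.
move=> t _; rewrite patchE; case: ifPn; last first.
  by move=> _; rewrite -EFinM lee_fin !mulr_ge0// exponential_pdf_ge0// ltW.
rewrite inE/= in_itv/= andbT => t1.
have t0 : 0 <= t by rewrite (le_trans ler01)// ltW.
rewrite -EFinM lee_fin exponential_pdfE// mulrA [2 * C]mulrC -[C * 2 * _]mulrA mulfV// mulr1.
rewrite /gammai.
have -> : expR (- t) = expR (- (t / 2)) * expR (- (t / 2)).
  by rewrite -expRD; congr expR; field.
have -> : - 2^-1 * t = - (t / 2) by field.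
rewrite mulrA ler_wpM2r ?expR_ge0//.
rewrite expRN ler_pdivrMr ?expR_gt0//.
apply: (@le_trans _ _ (t ^+ m.+1)).
  rewrite -powR_mulrn//; apply: ler_powR; first exact: ltW.
  by rewrite lerBlDr -natr1 -addrA (le_trans (ltW (truncnS_gt s)))// -natr1 lerD2l lerDl.
have := expR_ge1Dxn m (divr_ge0 t0 (ler0n _ 2)).
have -> : t ^+ m.+1 = C * ((t / 2) ^+ m.+1 / m.+1`!%:R).
  rewrite /C expr_div_n; field.
  by rewrite expf_neq0//= pnatr_eq0 -lt0n fact_gt0.
move=> h; rewrite ler_wpM2l//; apply: le_trans h.
by rewrite lerDr.
Qed.

Lemma Gamma_gt0 (s : R) : 0 < s -> 0 < Gamma s.
Proof.
move=> s0; rewrite /Gamma /Rintegral fine_gt0// Gamma_lty// andbT.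
apply: (@lt_le_trans _ _ (\int[leb]_(t in `[1%R, 2%R]) (cst (2^-1 * expR (- 2))%:E t))%E).
  rewrite integral_cst//= lebesgue_measure_itv/= lte_fin ltr1n -EFinB -EFinM lte_fin.
  by rewrite !mulr_gt0 ?expR_gt0 ?invr_gt0// subr_gt0 ltr1n.
apply: (@le_trans _ _ (\int[leb]_(t in `[1%R, 2%R]) (gammai s t)%:E)%E).
  apply: ge0_le_integral => //.
  - by move=> t _; rewrite lee_fin mulr_ge0 ?expR_ge0.
  - by apply: measurable_funTS; exact: measurable_gammai.
  move=> t; rewrite /= in_itv/= => /andP[t1 t2].
  have t0 : 0 < t by exact: lt_le_trans t1.
  rewrite lee_fin ler_pM ?expR_ge0 ?invr_ge0//; last by rewrite ler_expR lerN2.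
  have -> : t `^ (s - 1) = t `^ s / t by rewrite powRB ?(gt_eqF t0) ?implybT// powRr1 ?(ltW t0).
  rewrite ler_pdivlMr//; apply: (@le_trans _ _ 1).
    by rewrite mulrC ler_pdivrMr// mul1r.
  by rewrite -(powRr0 t) ler_powR// ltW.
apply: ge0_subset_integral => //.
- by apply: measurable_funTS; exact: measurable_gammai.
- by move=> t _; rewrite lee_fin gammai_ge0.
- by move=> t; rewrite /= !in_itv/= andbT => /andP[+ _]; exact: lt_le_trans.
Qed.

End Gamma_positive.

Section local_integrability.
Context {R : realType}.

Let h (s r t : R) : R := `|t| `^ (s - 1) * \1_(`[- r, r]%classic) t.

Let h_ge0 s r t : 0 <= h s r t.
Proof. by rewrite mulr_ge0 ?powR_ge0. Qed.

Let measurable_h s r : measurable_fun [set: R] (EFin \o h s r).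
Proof.
apply/measurable_EFinP/measurable_funM; last exact: measurable_indic.
exact: (measurableT_comp (measurable_powR (s - 1)) (@normr_measurable R setT)).
Qed.

(** The function is even, so the half-line suffices, and the integral over []0, r]] is already known
    to be finite. *)
Let integral_h_lty s r : 0 < s -> 0 < r ->
  (\int[lebesgue_measure]_t (h s r t)%:E < +oo)%E.
Proof.
move=> s0 r0.
have hN t : h s r (- t) = h s r t.
  by rewrite /h normrN !indicE; congr (_ * (_ : bool)%:R); apply/idP/idP;
    rewrite !inE/= !in_itv/= lerN2 lerNl andbC.
have mh D : measurable_fun D (EFin \o h s r) by apply: measurable_funTS; exact: measurable_h.
have half : (\int[lebesgue_measure]_(t in `[0%R, +oo[) (h s r t)%:E < +oo)%E.
  rewrite -integral_itv_obnd_cbnd//.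
  apply: le_lt_trans (integral_powR_lty s0 r0).
  rewrite integral_mkcond [leRHS]integral_mkcond.
  apply: ge0_le_integral => //.
  - by move=> t _; apply: erestrict_ge0 => x _; rewrite lee_fin h_ge0.
  - by apply/(measurable_restrictT _ _).1 => //; exact: mh.
  - apply/(measurable_restrictT _ _).1 => //.
    by apply/measurable_EFinP/measurable_funTS; exact: measurable_powR.
  move=> t _; rewrite !patchE !mem_setE !in_itv/= andbT.
  have -> : (point : \bar R) = 0%E by [].
  have [t0|_] := boolP (0 < t)%R; last by rewrite lexx.
  rewrite /h indicE mem_setE in_itv/= ger0_norm ?(ltW t0)//.
  have [tr|tr] := boolP (t <= r)%R.
    by rewrite lee_fin ler_piMr ?powR_ge0// lern1 leq_b1.
  by rewrite lee_fin andbF mulr0.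
have -> : [set: R] = `[0, +oo[%classic `|` `]-oo, 0[%classic.
  by rewrite setUC -itv_bndbnd_setU// set_itvE.
rewrite ge0_integral_setU//=; last 3 first.
- exact: mh.
- by move=> t _; rewrite lee_fin h_ge0.
- apply/disj_setPRL => t /=; rewrite !in_itv/= andbT => t0.
  by apply/negP; rewrite -ltNge.
apply: lte_add_pinfty => //.
apply: (@le_lt_trans _ _ (\int[lebesgue_measure]_(t in `]-oo, 0%R]) (h s r t)%:E)%E).
  apply: ge0_subset_integral => //=.
  - exact: mh.
  - by move=> t _; rewrite lee_fin h_ge0.
  - by move=> t; rewrite /= !in_itv/=; exact: ltW.
apply: le_lt_trans half.
rewrite [leRHS]ge0_integration_by_substitution0//.
- by under [leRHS]eq_integral do rewrite hN.
- by move=> t; rewrite lee_fin h_ge0.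
Qed.

Lemma integral_prod_coord n (g : R -> R) : measurable_fun [set: R] g -> (forall t, 0 <= g t) ->
  (\int[lebesgueN R n]_x (\prod_i g (x 0%R i))%:E =
   (\int[lebesgue_measure]_t (g t)%:E) ^+ n)%E.
Proof.
move=> mg g0.
have mp m : measurable_fun [set: 'rV[R]_m] (fun x => (\prod_i g (x 0 i))%:E).
  by apply/measurable_EFinP/measurable_prod => i _; apply: measurableT_comp => //; exact: measurable_coord.
elim: n => [|n IH].
  under eq_integral do rewrite big_ord0.
  by rewrite integral_cst//= diracE in_setT mule1.
rewrite ge0_integral_lebesgueS//; last first.
  by move=> x; rewrite lee_fin prodr_ge0.
have E a : (\int[lebesgueN R n]_y (\prod_i g (row_cons (a, y) 0%R i))%:E =
    ((\int[lebesgue_measure]_t (g t)%:E) ^+ n) * (g a)%:E)%E.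
  rewrite muleC -IH -ge0_integralZl_EFin//; last 2 first.
  - by move=> x _; rewrite lee_fin prodr_ge0.
  - exact: mp.
  apply: eq_integral => y _; rewrite big_ord_recl row_cons0 EFinM.
  by congr (_ * _%:E)%E; apply: eq_bigr => i _; rewrite row_consS.
under eq_integral do rewrite E.
rewrite ge0_integralZl//.
- by rewrite muleC -expeS.
- exact/measurable_EFinP.
- by move=> x _; rewrite lee_fin.
- by rewrite expe_ge0// integral_ge0// => t _; rewrite lee_fin.
Qed.

Lemma integral_prod_powR_lty n s r : 0 < s -> 0 < r ->
  (\int[lebesgueN R n]_x (\prod_i (`|x 0%R i| `^ (s - 1) *
     \1_(`[(- r)%R, r]%classic : set R) (x 0%R i)))%:E < +oo)%E.
Proof.
move=> s0 r0.
rewrite (@integral_prod_coord n (h s r)); last 2 first.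
- by apply/measurable_EFinP; exact: measurable_h.
- exact: h_ge0.
have /ge0_fin_numE <- : (0 <= (\int[lebesgue_measure]_t (h s r t)%:E) ^+ n)%E.
  by rewrite expe_ge0// integral_ge0// => t _; rewrite lee_fin h_ge0.
by rewrite fin_numX// ge0_fin_numE ?integral_h_lty// integral_ge0// => t _; rewrite lee_fin h_ge0.
Qed.

End local_integrability.

Section riesz_kernel.
Context {R : realType} {N : nat}.
Local Notation E := 'rV[R]_N.
Local Notation mu := (lebesgueN R N).
Variables (alpha : R).
Hypotheses (N_ge1 : (1 <= N)%N) (alpha_gt0 : 0 < alpha) (alpha_ltN : alpha < N%:R).

Let N0 : 0 < N%:R :> R. Proof. by rewrite ltr0n. Qed.

Lemma enorm_ge0 (x : E) : 0 <= enorm x.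
Proof. exact: sqrtr_ge0. Qed.

Lemma enormN (x : E) : enorm (- x) = enorm x.
Proof. by rewrite /enorm; under eq_bigr do rewrite mxE sqrrN. Qed.

Lemma enormZ t (x : E) : 0 <= t -> enorm (t *: x) = t * enorm x.
Proof.
move=> t0; rewrite /enorm; under eq_bigr do rewrite mxE exprMn.
by rewrite -mulr_sumr sqrtrM ?sqr_ge0// sqrtr_sqr ger0_norm.
Qed.

Lemma coord_le_enorm (x : E) i : `|x 0 i| <= enorm x.
Proof.
rewrite -sqrtr_sqr ler_wsqrtr// (bigD1 i)//= lerDl sumr_ge0// => j _.
exact: sqr_ge0.
Qed.

Lemma enorm_le_box (x : E) (r : R) : box r x -> enorm x <= N%:R * r.
Proof.
move=> xr; rewrite -(ler_sqr (enorm_ge0 x)) ?nnegrE; last first.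
  by rewrite mulr_ge0// (le_trans _ (xr (Ordinal N_ge1))).
rewrite sqr_sqrtr ?sumr_ge0// => [|i _]; last exact: sqr_ge0.
apply: (@le_trans _ _ (\sum_(i < N) r ^+ 2)).
  apply: ler_sum => i _; rewrite -[leLHS]ger0_norm ?sqr_ge0// normrX.
  by rewrite lerXn2r ?nnegrE// (le_trans _ (xr i)).
rewrite sumr_const card_ord -[leLHS]mulr_natl exprMn ler_wpM2r ?sqr_ge0//.
by rewrite -natrX ler_nat leq_pmulr// expn_gt0 N_ge1.
Qed.

Let c := Gamma ((N%:R - alpha) / 2) /
  (2 `^ alpha * pi `^ (N%:R / 2) * Gamma (alpha / 2)).

Let c_gt0 : 0 < c.
Proof.
rewrite /c divr_gt0 ?mulr_gt0 ?powR_gt0 ?pi_gt0 ?Gamma_gt0 ?divr_gt0 ?subr_gt0//.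
Qed.

Let rieszE (x : E) : riesz alpha x = c / enorm x `^ (N%:R - alpha).
Proof. by rewrite /riesz /c [in LHS]invfM mulrA. Qed.

Lemma riesz_ge0 (x : E) : 0 <= riesz alpha x.
Proof. by rewrite rieszE divr_ge0 ?powR_ge0// ltW. Qed.

Lemma measurable_riesz : measurable_fun [set: E] (riesz alpha).
Proof.
have -> : riesz alpha = (fun t => c * t `^ (alpha - N%:R)) \o @enorm R N.
  by apply/funext => x /=; rewrite rieszE -powRN opprB.
apply: (@measurableT_comp _ _ _ _ _ _ (fun t => c * t `^ (alpha - N%:R))).
  apply: measurable_funM => //; exact: measurable_powR.
exact: measurable_enorm.
Qed.

Lemma rieszN (x : E) : riesz alpha (- x) = riesz alpha x.
Proof. by rewrite !rieszE enormN. Qed.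

Lemma rieszZ t (x : E) : 0 < t -> riesz alpha (t *: x) = t `^ (alpha - N%:R) * riesz alpha x.
Proof.
move=> t0; rewrite !rieszE enormZ ?(ltW t0)// powRM ?(ltW t0) ?enorm_ge0//.
by rewrite invfM -[(t `^ _)^-1]powRN opprB mulrCA.
Qed.

(** Used to show that some function has a positive Choquard integral. The origin is excluded because
    [riesz] takes the default value 0 there. *)
Lemma riesz_ge_box (r : R) : 0 < r ->
  exists2 k, 0 < k & forall x : E, x != 0 -> box r x -> k <= riesz alpha x.
Proof.
move=> r0; exists (c / (N%:R * r) `^ (N%:R - alpha)).
  by apply: divr_gt0 => //; apply: powR_gt0; exact: mulr_gt0.
move=> x x0 xr.
have e0 : 0 < enorm x.
  rewrite lt_neqAle enorm_ge0 andbT eq_sym; apply: contra_neq x0 => ex0.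
  apply/rowP => i; rewrite mxE; apply/eqP; rewrite -normr_le0 -ex0.
  exact: coord_le_enorm.
have en := enorm_le_box xr.
rewrite rieszE ler_wpM2l ?(ltW c_gt0)// lef_pV2 ?posrE ?powR_gt0 ?mulr_gt0//.
by apply: ge0_ler_powR; rewrite ?nnegrE ?subr_ge0 ?(ltW alpha_ltN) ?enorm_ge0// (le_trans _ en)// enorm_ge0.
Qed.

(* Each of the [N] factors of [enorm x `^ (alpha - N)] is bounded by a single
   coordinate, so that local integrability reduces to dimension one. *)
Lemma riesz_le_prod (x : E) : (forall i, x 0 i != 0) ->
  riesz alpha x <= c * \prod_i `|x 0 i| `^ (alpha / N%:R - 1).
Proof.
move=> x0.
rewrite rieszE ler_wpM2l ?(ltW c_gt0)// -powRN opprB.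
have e0 : 0 < enorm x.
  by apply: lt_le_trans (coord_le_enorm x (Ordinal N_ge1)); rewrite normr_gt0.
have -> : enorm x `^ (alpha - N%:R) = \prod_(i < N) (enorm x `^ (alpha / N%:R - 1)).
  rewrite prodr_const card_ord -powR_mulrn ?powR_ge0// -powRrM; congr (_ `^ _).
  by field; rewrite gt_eqF.
apply: ler_prod => i _; rewrite powR_ge0/=.
rewrite -[alpha / _ - 1]opprB !powRN lef_pV2 ?posrE ?powR_gt0 ?normr_gt0//.
apply: ge0_ler_powR; rewrite ?nnegrE ?coord_le_enorm ?enorm_ge0//.
by rewrite subr_ge0 ler_pdivrMr// mul1r ltW.
Qed.

(** The bound [riesz_le_prod] is available only off the coordinate hyperplanes. Each of these is a
    product set with one factor [[set 0]] of measure 0. *)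
Lemma ae_coord_neq0 : {ae mu, forall x : E, forall i, x 0 i != 0}.
Proof.
apply: filter_forall => i.
pose A (j : 'I_N) : set (measurableTypeR R) := if j == i then [set 0] else setT.
have mA j : measurable (A j) by rewrite /A; case: ifPn.
exists [set x : E | forall j, A j (x 0 j)]; split.
- exact: measurable_rV_prod.
- rewrite lebesgueN_box// (bigD1 i)//= {1}/A eqxx.
  by rewrite lebesgue_measure_set1 mul0e.
- move=> x /= /negP; rewrite negbK => /eqP xi j; rewrite /A.
  by case: eqVneq => [->|].
Qed.

Lemma integral_riesz_box_lty r :
  (\int[mu]_x (riesz alpha x * \1_(box r) x)%:E < +oo)%E.
Proof.
(* The one-dimensional estimate needs a positive radius, and enlarging the cube only increases the
   integral. *)
wlog r0 : r / 0 < r.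
  move=> /(_ (Num.max r 1)); rewrite lt_max ltr01 orbT => /(_ isT).
  apply: le_lt_trans; apply: ge0_le_integral => //.
  - by move=> x _; rewrite lee_fin mulr_ge0 ?riesz_ge0.
  - apply/measurable_EFinP/measurable_funM; first exact: measurable_riesz.
    by apply: measurable_indic; exact: measurable_box.
  - apply/measurable_EFinP/measurable_funM; first exact: measurable_riesz.
    by apply: measurable_indic; exact: measurable_box.
  - move=> x _; rewrite lee_fin ler_wpM2l ?riesz_ge0// !indicE ler_nat.
    case: (boolP (x \in box r)) => // /set_mem xr.
    by rewrite mem_set//; apply: box_sub xr; rewrite le_max lexx.
have s0 : 0 < alpha / N%:R by exact: divr_gt0.
have mg : measurable_fun [set: E] (fun x => (\prod_i (`|x 0 i| `^ (alpha / N%:R - 1) *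
     \1_(`[(- r)%R, r]%classic : set R) (x 0 i)))%:E).
  apply/measurable_EFinP/measurable_prod => i _.
  apply: measurable_funM.
    apply: (measurableT_comp (measurable_powR (alpha / N%:R - 1))).
    by apply: measurableT_comp => //; exact: measurable_coord.
  by apply: measurableT_comp => //; exact: measurable_coord.
have g0 x : (0 <= (\prod_i (`|x 0%R i| `^ (alpha / N%:R - 1) *
     \1_(`[(- r)%R, r]%classic : set R) (x 0%R i)))%:E :> \bar R)%E.
  by rewrite lee_fin prodr_ge0// => i _; rewrite mulr_ge0 ?powR_ge0.
apply: (@le_lt_trans _ _ (c%:E * \int[mu]_x (\prod_i (`|x 0%R i| `^ (alpha / N%:R - 1) *
     \1_(`[(- r)%R, r]%classic : set R) (x 0%R i)))%:E)%E); last first.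
  rewrite lte_mul_pinfty ?integral_prod_powR_lty// lee_fin ltW//.
rewrite -ge0_integralZl_EFin//; last by rewrite ltW.
apply: ae_ge0_le_integral => //.
- by move=> x _; rewrite lee_fin mulr_ge0 ?riesz_ge0.
- apply/measurable_EFinP/measurable_funM; first exact: measurable_riesz.
  by apply: measurable_indic; exact: measurable_box.
- by move=> x _; rewrite mule_ge0// lee_fin ltW.
- exact: measurable_funeM.
apply: filterS ae_coord_neq0 => x x0 _.
rewrite -EFinM lee_fin indicE.
case: (boolP (x \in box r)) => [/set_mem xr|_]; last first.
  by rewrite mulr0 mulr_ge0 ?(ltW c_gt0)// prodr_ge0// => i _; rewrite mulr_ge0 ?powR_ge0.
rewrite mulr1; apply: le_trans (riesz_le_prod x0) _.
rewrite ler_wpM2l ?(ltW c_gt0)//; apply: ler_prod => i _; rewrite powR_ge0/=.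
by rewrite indicE mem_set ?mulr1//= in_itv/= -ler_norml.
Qed.

End riesz_kernel.

Section choquard_functional.
Context {R : realType} {N : nat}.
Local Notation E := 'rV[R]_N.
Local Notation mu := (lebesgueN R N).
Variables (alpha : R).
Hypotheses (N_ge1 : (1 <= N)%N) (alpha_gt0 : 0 < alpha) (alpha_ltN : alpha < N%:R).

Let N0 : 0 < N%:R :> R. Proof. by rewrite ltr0n. Qed.

Local Notation K := (@riesz R N alpha).
Local Notation p := (alpha / N%:R + 1).

Let p1 : 1 <= p. Proof. by rewrite lerDr divr_ge0// ltW. Qed.
Let p0 : 0 < p. Proof. exact: lt_le_trans p1. Qed.

Let w (u : E -> R) x := `|u x| `^ p.

Let w_ge0 u x : 0 <= w u x. Proof. exact: powR_ge0. Qed.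

Let measurable_w (u : E -> R) : measurable_fun [set: E] u -> measurable_fun [set: E] (w u).
Proof.
move=> mu'; apply: (measurableT_comp (measurable_powR p)).
exact: measurableT_comp.
Qed.

Let kernel (f : E -> R) (z : E * E) := (K (z.1 - z.2) * f z.2)%:E.

Let measurable_kernel (f : E -> R) : measurable_fun [set: E] f -> measurable_fun [set: E * E] (kernel f).
Proof.
move=> mf; apply/measurable_EFinP/measurable_funM.
  apply: (measurableT_comp (measurable_riesz alpha)).
  exact: measurable_sub_rV.
exact: (measurableT_comp mf measurable_snd).
Qed.

Let measurable_kernel_comp (f : E -> R) (g : E -> E) x :
  measurable_fun [set: E] f -> measurable_fun [set: E] g ->
  measurable_fun [set: E] (fun y => kernel f (x, g y)).
Proof.
move=> mf mg; apply: (@measurableT_comp _ _ _ _ _ _ (kernel f) _ (fun y => (x, g y))).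
  exact: measurable_kernel.
exact/measurable_fun_pair.
Qed.

Let kernel_ge0 (f : E -> R) z : (forall x, 0 <= f x) -> (0 <= kernel f z)%E.
Proof. by move=> f0; rewrite lee_fin mulr_ge0 ?riesz_ge0. Qed.

Let measurable_convolution (f : E -> R) : measurable_fun [set: E] f -> (forall x, 0 <= f x) ->
  measurable_fun [set: E] (convolution K f).
Proof.
move=> mf f0.
apply: (@measurable_fun_fubini_tonelli_F _ _ _ _ _ mu (kernel f)).
  exact: measurable_kernel.
by move=> z; exact: kernel_ge0.
Qed.

Let convolution_ge0 (f : E -> R) x : (forall x, 0 <= f x) -> (0 <= convolution K f x)%E.
Proof. by move=> f0; apply: integral_ge0 => y _; exact: (kernel_ge0 (x, y)). Qed.

Let measurable_integrand (u : E -> R) : measurable_fun [set: E] u ->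
  measurable_fun [set: E] (fun x => convolution K (w u) x * (w u x)%:E)%E.
Proof.
move=> mu'; apply: emeasurable_funM.
  by apply: measurable_convolution => //; exact: measurable_w.
by apply/measurable_EFinP; exact: measurable_w.
Qed.

Lemma choquard_ge0 (u : E -> R) : (0 <= choquard alpha u)%E.
Proof.
apply: integral_ge0 => x _; rewrite mule_ge0 ?lee_fin ?powR_ge0//.
exact: convolution_ge0.
Qed.

(** On the support of [u] the convolution is bounded by a constant times the integral of the kernel
    over a larger cube, and the weight is integrable. *)
Lemma choquard_lty (u : E -> R) : bcs u -> (choquard alpha u < +oo)%E.
Proof.
move=> [mu' [B [uB ur]]].
pose M := B `^ p.
have B0 : 0 <= B by exact: le_trans (uB 0).
have wM x : w u x <= M * \1_(box B) x.
  rewrite /w; have [->|/ur xB] := eqVneq (u x) 0.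
    by rewrite normr0 powR0 ?gt_eqF// mulr_ge0 ?powR_ge0.
  by rewrite indicE mem_set// mulr1 ge0_ler_powR ?nnegrE ?(ltW p0).
have wint : (\int[mu]_x (w u x)%:E < +oo)%E.
  apply: (@le_lt_trans _ _ (\int[mu]_x (M%:E * (\1_(box B) x)%:E))%E).
    apply: ge0_le_integral => //.
    - by move=> x _; rewrite lee_fin w_ge0.
    - by apply/measurable_EFinP; exact: measurable_w.
    - by apply: measurable_funeM; apply/measurable_EFinP/measurable_indic; exact: measurable_box.
    - by move=> x _; rewrite -EFinM lee_fin.
  rewrite ge0_integralZl_EFin ?powR_ge0//; last first.
    by apply/measurable_EFinP/measurable_indic; exact: measurable_box.
  rewrite integral_indic ?setIT; [|exact: measurableT|exact: measurable_box].
  by rewrite lte_mul_pinfty ?lee_fin ?powR_ge0// lebesgueN_box_lty.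
(* The radius is [B + B] because the kernel is evaluated at differences of two points of [box B]. *)
pose J := (\int[mu]_x (K x * \1_(box (B + B)) x)%:E)%E.
have Joo : (J < +oo)%E by exact: integral_riesz_box_lty.
have J0 : (0 <= J)%E by apply: integral_ge0 => x _; rewrite lee_fin mulr_ge0 ?riesz_ge0.
have convJ x : box B x -> (convolution K (w u) x <= M%:E * J)%E.
  move=> xB; rewrite /convolution /J.
  rewrite -[leLHS](@ge0_integral_affine R N 1 x)//; last 2 first.
  - exact: (@measurable_kernel_comp (w u) id x (measurable_w mu')).
  - by move=> y; exact: (kernel_ge0 (x, y)).
  rewrite expr1n mul1e -ge0_integralZl_EFin ?powR_ge0//; last 2 first.
  - by move=> y _; rewrite lee_fin mulr_ge0 ?riesz_ge0.
  - apply/measurable_EFinP/measurable_funM; first exact: measurable_riesz.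
    by apply: measurable_indic; exact: measurable_box.
  apply: ge0_le_integral => //.
  - by move=> y _; rewrite lee_fin mulr_ge0 ?riesz_ge0.
  - apply: (@measurable_kernel_comp (w u) (fun y => 1 *: y + x) x (measurable_w mu')).
    exact: measurable_affine.
  - apply: measurable_funeM; apply/measurable_EFinP/measurable_funM; first exact: measurable_riesz.
    by apply: measurable_indic; exact: measurable_box.
  move=> y _; rewrite scale1r opprD addrCA subrr addr0 rieszN -EFinM lee_fin.
  rewrite mulrCA ler_wpM2l ?riesz_ge0//; apply: le_trans (wM _) _.
  rewrite ler_wpM2l ?powR_ge0// !indicE ler_nat.
  case: (boolP (y + x \in box B)) => // /set_mem yx; rewrite mem_set// => i.
  have -> : y 0 i = (y + x) 0 i - x 0 i by rewrite !mxE addrK.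
  exact: le_trans (ler_normB _ _) (lerD (yx i) (xB i)).
apply: (@le_lt_trans _ _ (\int[mu]_x ((M%:E * J) * (w u x)%:E))%E).
  apply: ge0_le_integral => //.
  - by move=> x _; rewrite mule_ge0 ?lee_fin ?powR_ge0// convolution_ge0.
  - exact: measurable_integrand.
  - apply: emeasurable_funM => //; apply/measurable_EFinP; exact: measurable_w.
  move=> x _; rewrite -/(w u) -/(w u x).
  have [ux0|/ur xB] := eqVneq (u x) 0.
    have -> : w u x = 0 by rewrite /w ux0 normr0 powR0 ?gt_eqF.
    by rewrite !mule0.
  by rewrite lee_wpmul2r ?lee_fin ?powR_ge0// convJ.
rewrite ge0_integralZl//.
- apply: lte_mul_pinfty => //; last by rewrite fin_numM// ge0_fin_numE.
  by rewrite mule_ge0 ?lee_fin ?powR_ge0.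
- by apply/measurable_EFinP; exact: measurable_w.
- by move=> x _; rewrite lee_fin powR_ge0.
- by rewrite mule_ge0 ?lee_fin ?powR_ge0.
Qed.

(** The kernel contributes [s]^ (N - alpha)[by homogeneity, each of the two integrations a factor](s
    ^+ N)^-1[, and each of the two weights a factor]a [^ p]. *)
Lemma choquard_affine (u : E -> R) (a s : R) (b : E) : 0 <= a -> 0 < s ->
  measurable_fun [set: E] u ->
  choquard alpha (fun x => a * u (s *: x + b)) =
  (((a `^ p) ^+ 2 * s `^ (N%:R - alpha) / (s ^+ N) ^+ 2)%:E * choquard alpha u)%E.
Proof.
move=> a0 s0 mu'.
have wE x : w (fun x => a * u (s *: x + b)) x = a `^ p * w u (s *: x + b).
  by rewrite /w normrM (ger0_norm a0) powRM.
have KE (x y : E) : K (x - y) = s `^ (N%:R - alpha) * K ((s *: x + b) - (s *: y + b)).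
  rewrite opprD addrACA subrr addr0 -scalerBr rieszZ// mulrA -powRD.
    by rewrite addrA subrK subrr powRr0 mul1r.
  by rewrite (gt_eqF s0) implybT.
have convE x : convolution K (w (fun x => a * u (s *: x + b))) x =
    ((a `^ p * s `^ (N%:R - alpha) / s ^+ N)%:E * convolution K (w u) (s *: x + b)%R)%E.
  rewrite /convolution.
  transitivity (\int[mu]_y ((a `^ p * s `^ (N%:R - alpha))%:E *
      kernel (w u) (s *: x + b, s *: y + b)%R))%E.
    apply: eq_integral => y _; rewrite wE KE -EFinM; congr EFin.
    by rewrite /= mulrACA [RHS]mulrC [X in X * _ = _]mulrC; ring.
  rewrite ge0_integralZl_EFin//; last 3 first.
  - by move=> y _; exact: kernel_ge0.
  - apply: measurable_kernel_comp; first exact: measurable_w.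
    exact: measurable_affine.
  - by rewrite mulr_ge0 ?powR_ge0.
  rewrite (@ge0_integral_affineV R N s b (fun y => kernel (w u) (s *: x + b, y)))//; last 2 first.
  - by apply: measurable_kernel_comp => //; exact: measurable_w.
  - by move=> y; exact: kernel_ge0.
  by rewrite muleA -EFinM.
rewrite /choquard.
under eq_integral do rewrite -/(w (fun x => a * u (s *: x + b))) -/(w (fun x => a * u (s *: x + b)) _) convE wE.
pose f x := (convolution K (w u) x * (w u x)%:E)%E.
rewrite -[X in (_ * X)%E]/(\int[mu]_x f x)%E.
transitivity (\int[mu]_x (((a `^ p) ^+ 2 * s `^ (N%:R - alpha) / s ^+ N)%:E * f (s *: x + b)%R))%E.
  apply: eq_integral => x _; rewrite /f [X in (_ * X)%E = _]EFinM muleACA -EFinM; congr (_%:E * _)%E.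
  by ring.
have mf : measurable_fun [set: E] f by exact: measurable_integrand.
have f0 x : (0 <= f x)%E by rewrite mule_ge0 ?lee_fin ?powR_ge0// convolution_ge0.
clearbody f.
rewrite ge0_integralZl_EFin//; last 2 first.
- by apply: (measurableT_comp mf); exact: measurable_affine.
- by rewrite !mulr_ge0 ?powR_ge0 ?exprn_ge0 ?invr_ge0 ?powR_ge0 ?exprn_ge0 ?(ltW s0).
rewrite ge0_integral_affineV// muleA -EFinM; congr (_%:E * _)%E.
by rewrite [in RHS]expr2 [in RHS]invfM [RHS]mulrA.
Qed.

Let G (u : E -> R) (z : E * E) := (K (z.1 - z.2) * w u z.2 * w u z.1)%:E.

Let G_ge0 u z : (0 <= G u z)%E.
Proof. by rewrite lee_fin; do 2?[apply: mulr_ge0 => //]; exact: riesz_ge0. Qed.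

Let measurable_G (u : E -> R) : measurable_fun [set: E] u -> measurable_fun [set: E * E] (G u).
Proof.
move=> mu'; apply/measurable_EFinP/measurable_funM.
  apply: measurable_funM; last exact: (measurableT_comp (measurable_w mu') measurable_snd).
  apply: (measurableT_comp (measurable_riesz alpha)); exact: measurable_sub_rV.
exact: (measurableT_comp (measurable_w mu') measurable_fst).
Qed.

(** As a single integral over the product space, the functional can be treated by one application of
    Fatou's lemma. *)
Lemma choquardE (u : E -> R) : measurable_fun [set: E] u ->
  choquard alpha u = (\int[mu \x mu]_z
    (K (z.1 - z.2) * `|u z.2| `^ p * `|u z.1| `^ p)%:E)%E.
Proof.
move=> mu'; rewrite -[RHS]/(\int[mu \x mu]_z G u z)%E.
rewrite fubini_tonelli1//; last exact: measurable_G.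
apply: eq_integral => x _; rewrite muleC -ge0_integralZl_EFin ?powR_ge0//; last 2 first.
- by move=> y _; exact: (@kernel_ge0 (w u) (x, y)).
- by apply: (@measurable_kernel_comp (w u) id x) => //; exact: measurable_w.
by apply: eq_integral => y _; rewrite -EFinM mulrC.
Qed.

Let cvg_w (u_ : nat -> R) (u : R) : u_ k @[k --> \oo] --> u ->
  `|u_ k| `^ p @[k --> \oo] --> `|u| `^ p.
Proof.
move=> cu.
have [u0|u0] := eqVneq u 0; last first.
  have nu0 : 0 < `|u| by rewrite normr_gt0.
  exact: (cvg_comp _ _ (cvg_norm cu) (@continuous_powR_gt0 R p _ nu0)).
rewrite u0 normr0 powR0 ?gt_eqF//.
rewrite u0 in cu.
apply: (@squeeze_cvgr _ _ _ _ (cst 0) (fun k => `|u_ k|)).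
- have /cvgrPdist_le/(_ 1 ltr01) := cu.
  apply: filterS => k; rewrite sub0r normrN powR_ge0/= => uk1.
  have [->|uk0] := eqVneq (u_ k) 0; first by rewrite normr0 powR0 ?gt_eqF.
  by rewrite ge1r_powR// normr_gt0 uk0.
- exact: cvg_cst.
- by rewrite -[X in _ --> X](@normr0 _ R); exact: cvg_norm.
Qed.

Lemma choquard_fatou (u_ : nat -> E -> R) (u : E -> R) :
  (forall k, measurable_fun [set: E] (u_ k)) -> measurable_fun [set: E] u ->
  {ae mu, forall x, u_ k x @[k --> \oo] --> u x} ->
  (choquard alpha u <= limn_einf (fun k => choquard alpha (u_ k)))%E.
Proof.
move=> mu_ mu' [Z [mZ Z0 uZ]].
have mZT : measurable (Z `*` [set: E]) by exact: measurableX.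
have mTZ : measurable ([set: E] `*` Z) by exact: measurableX.
(* The integrand converges at every pair with both entries outside [Z]; the remaining pairs form a
   null set of the product, which is removed before applying Fatou's lemma. *)
pose Y := Z `*` [set: E] `|` [set: E] `*` Z.
have mY : measurable Y by exact: measurableU.
have Y0 : (mu \x mu)%E Y = 0%E.
  have TZ0 : (mu \x mu)%E ([set: E] `*` Z) = 0%E by rewrite product_measure1E// Z0 mule0.
  have ZT0 : (mu \x mu)%E (Z `*` [set: E]) = 0%E.
    by transitivity (mu Z * mu setT)%E; [exact: product_measure1E|rewrite Z0 mul0e].
  by rewrite -[RHS]ZT0; exact: measureU0.
have restrictE v : measurable_fun [set: E] v ->
    choquard alpha v = (\int[mu \x mu]_(z in setT `\` Y) G v z)%E.
  move=> mv; rewrite choquardE//; apply: ge0_negligible_integral => //.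
    exact: measurable_G.
  by move=> z _; exact: G_ge0.
rewrite restrictE//; under [in leRHS]eq_fun do rewrite restrictE//.
apply: le_trans; last first.
  apply: fatou.
  - exact: measurableD.
  - by move=> k; apply: measurable_funTS; exact: measurable_G.
  - by move=> k z _; exact: G_ge0.
rewrite le_eqVlt; apply/orP; left; apply/eqP; apply: eq_integral => z.
rewrite inE => -[_ /not_orP[z1 z2]].
have c1 : u_ k z.1 @[k --> \oo] --> u z.1.
  by apply: contrapT => h; apply: z1; split => //; exact: uZ.
have c2 : u_ k z.2 @[k --> \oo] --> u z.2.
  by apply: contrapT => h; apply: z2; split => //; exact: uZ.
have cG : G (u_ k) z @[k --> \oo] --> G u z.
  apply: cvg_EFin; first exact: nearW.
  apply: cvgM; last exact: cvg_w.
  by apply: cvgM; [exact: cvg_cst|exact: cvg_w].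
by rewrite (cvg_limn_einf_sup cG).1.
Qed.

(** Two disjoint unit cubes inside [box 1] keep the pairs off the diagonal, so the kernel has a
    positive lower bound on their product. *)
Lemma choquard_indic_box_gt0 : (0 < choquard alpha (\1_(box 1) : E -> R))%E.
Proof.
have mbox : measurable_fun [set: E] (\1_(box 1) : E -> R).
  by apply: measurable_indic; exact: measurable_box.
have [k k0 kK] := @riesz_ge_box R N alpha N_ge1 alpha_gt0 alpha_ltN 2 (ltr0n _ 2).
pose A : set E := [set x | forall i, `]0%R, 1%R]%classic (x 0 i)].
pose B : set E := [set x | forall i, `[(- 1)%R, 0%R[%classic (x 0 i)].
have mA : measurable A by exact: (@measurable_rV_prod _ _ (fun=> `]0%R, 1%R]%classic)).
have mB : measurable B by exact: (@measurable_rV_prod _ _ (fun=> `[(- 1)%R, 0%R[%classic)).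
have A1 : mu A = 1%E.
  rewrite (@lebesgueN_box R N (fun=> `]0%R, 1%R]%classic))// big1// => i _.
  by rewrite lebesgue_measure_itv/= lte_fin ltr01 -EFinB subr0.
have B1 : mu B = 1%E.
  rewrite (@lebesgueN_box R N (fun=> `[(- 1)%R, 0%R[%classic))// big1// => i _.
  by rewrite lebesgue_measure_itv/= lte_fin oppr_lt0 ltr01 -EFinB sub0r opprK.
have mAB : measurable (A `*` B) by exact: measurableX.
rewrite choquardE//.
apply: (@lt_le_trans _ _ (\int[mu \x mu]_(z in A `*` B) (cst k%:E z))%E).
  rewrite integral_cst//.
  rewrite [X in (_ * X)%E](_ : _ = 1%E) ?mule1 ?lte_fin//.
  by transitivity (mu A * mu B)%E; [exact: product_measure1E|rewrite A1 B1 mule1].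
apply: (@le_trans _ _ (\int[mu \x mu]_(z in A `*` B) G \1_(box 1) z)%E); last first.
  by apply: ge0_subset_integral => //; exact: measurable_G.
apply: ge0_le_integral => //.
- by move=> z _; rewrite lee_fin ltW.
- by apply: measurable_funTS; exact: measurable_G.
move=> z [zA zB].
have z1 : box 1 z.1.
  move=> i; have := zA i; rewrite /= in_itv/= => /andP[/ltW a0 a1].
  by rewrite ger0_norm.
have z2 : box 1 z.2.
  move=> i; have := zB i; rewrite /= in_itv/= => /andP[a1 /ltW a0].
  by rewrite ler0_norm// lerNl.
rewrite lee_fin /w !indicE !mem_set// normr1 powR1 !mulr1.
apply: kK.
  rewrite subr_eq0; apply/eqP => z12.
  have := zA (Ordinal N_ge1); have := zB (Ordinal N_ge1).
  rewrite -z12 /= !in_itv/= => /andP[_ a0] /andP[a1 _].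
  by have := lt_trans a0 a1; rewrite ltxx.
by move=> i; rewrite !mxE (le_trans (ler_normB _ _))// -[2]/(1 + 1) lerD.
Qed.

End choquard_functional.

(** * Weak derivatives of averages along segments *)

Section right_averages.
Context {R : realType}.
Local Notation leb := (@lebesgue_measure R).

(** These averages are difference quotients, with step [1 / (k + 1)], of the primitive of [F] from
    [-oo], which is a.e. differentiable with derivative [F]. *)
Lemma ae_cvg_right_average (F : R -> R) : leb.-integrable setT (EFin \o F) ->
  {ae leb, forall t, k.+1%:R * (\int[leb]_r (F (r + t) * \1_(`[0, k.+1%:R^-1]%classic) r))
     @[k --> \oo] --> F t}.
Proof.
move=> iF.
have iFD D : measurable D -> leb.-integrable D (EFin \o F).
  by move=> mD; exact: integrableS iF.
have locF : locally_integrable setT F.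
  by apply: open_integrable_locally => //; exact: openT.
have := FTC1Ny (fun y => iFD _ (measurable_itv `]-oo, y])) locF.
apply: filterS; first exact: (ae_filter_ringOfSetsType leb).
move=> t [dF <-].
set G := (fun x => _) in dF *.
have avgE k : k.+1%:R * (\int[leb]_r (F (r + t) * \1_(`[0, k.+1%:R^-1]%classic) r)) =
    (k.+1%:R^-1)^-1 *: ((G \o shift t) (k.+1%:R^-1 *: (1:R)) - G t).
  rewrite invrK /= [_%:A]mulr1; congr (_ * _).
  have kt : t < k.+1%:R^-1 + t by rewrite ltrDr invr_gt0.
  rewrite /G Rintegral_itvB//; last 2 first.
  - exact: iFD.
  - by rewrite bnd_simp ltW.
  rewrite Rintegral_itv_obnd_cbnd; last exact: iFD.
  have mF : measurable_fun setT (EFin \o (F \_ `[t, k.+1%:R^-1 + t])).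
    apply/measurable_EFinP/(measurable_restrictT _ _).1 => //.
    apply: measurable_funTS; apply/measurable_EFinP; exact: measurable_int iF.
  rewrite Rintegral_mkcond /Rintegral; congr fine.
  rewrite -(integral_translate1 t mF); apply: eq_integral => r _.
  rewrite /= patchE indicE; congr EFin.
  have -> : (r + t \in `[t, k.+1%:R^-1 + t]%classic) = (r \in `[0, k.+1%:R^-1]%classic).
    by rewrite !mem_setE !in_itv/= lerD2r lerDr.
  by case: ifPn; rewrite ?mulr1 ?mulr0.
under eq_fun do rewrite avgE.
rewrite derive1E.
apply: (cvgr_dnbhsP _ _ _).1 dF _ _; split.
  by move=> k; rewrite invr_neq0.
exact: cvg_harmonic.
Qed.

End right_averages.

Section C1_functions.
Context {R : realType} {N : nat}.
Local Notation E := 'rV[R]_N.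

Definition C1 (phi : E -> R) := [/\ continuous phi,
  forall i x, derivable phi x (Defs.basis i) &
  forall i, continuous (fun x => 'D_(Defs.basis i) phi x)].

Lemma test_function_C1 phi : test_function phi -> C1 phi.
Proof.
move=> [c d _]; split.
- exact: (c [::]).
- by move=> i x; exact: (d [::]).
- by move=> i; exact: (c [:: i]).
Qed.

Lemma is_derive_line (phi : E -> R) (y e : E) (t : R) :
  derivable phi (y + t *: e) e ->
  is_derive t 1 (fun t => phi (y + t *: e)) ('D_e phi (y + t *: e)).
Proof.
move=> d.
have E0 : (fun h : R => h^-1 *: (((fun t => phi (y + t *: e)) \o shift t) (h *: (1:R)) -
      phi (y + t *: e))) =
    (fun h => h^-1 *: ((phi \o shift (y + t *: e)) (h *: e) - phi (y + t *: e))).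
  apply/funext => h /=; congr (_ *: (phi _ - _)).
  by rewrite [_%:A]mulr1 scalerDl addrCA.
by split; rewrite /derivable /derive E0.
Qed.

(** Only the directional derivative along [e] is assumed to exist, so the chain rule is applied to
    the restriction of [phi] to a line. *)
Lemma derive_affine (phi : E -> R) (s : R) (b e x : E) :
  (forall y, derivable phi y e) ->
  derivable (fun x => phi (s *: x + b)) x e /\
  'D_e (fun x => phi (s *: x + b)) x = s * 'D_e phi (s *: x + b).
Proof.
move=> d; set f := (fun x => _).
have Ef h : f (h *: e + x) = (fun t => phi ((s *: x + b) + t *: e)) (s * h).
  by rewrite /f scalerDr scalerA -addrA addrC.
have dl : is_derive (s * 0) 1 (fun t => phi ((s *: x + b) + t *: e)) ('D_e phi (s *: x + b + (s * 0) *: e)).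
  exact: is_derive_line.
have ds : is_derive (0 : R) 1 (fun h : R => s * h) s.
  have := @is_deriveZ _ _ _ id s (0 : R) 1 1 (is_derive_id _ _).
  by rewrite [_%:A]mulr1.
have dc := is_derive1_comp dl ds.
have fE : (fun h : R => f (h *: e + x)) = (fun t => phi ((s *: x + b) + t *: e)) \o (fun h => s * h).
  by apply/funext => h /=; rewrite Ef.
split.
  by apply/derivable1P; rewrite fE; case: dc.
have -> : 'D_e f x = 'D_1 (fun h : R => f (h *: e + x)) 0.
  rewrite /derive; set g1 := fun h => h^-1 *: _; set g2 := fun h => h^-1 *: _.
  suff -> : g1 = g2 by [].
  by apply/funext => h; rewrite /g1 /g2 /= addr0 scale0r add0r [_%:A]mulr1.
by rewrite fE derive_val mulr0 scale0r addr0 mulrC.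
Qed.

Lemma continuous_affine (s : R) (b : E) : continuous (fun x : E => s *: x + b).
Proof.
move=> x; apply: (@continuousD _ _ _ (fun x : E => s *: x) (cst b)).
  exact: scaler_continuous.
exact: cst_continuous.
Qed.

Lemma C1_affine (phi : E -> R) (s : R) (b : E) : C1 phi -> C1 (fun x => phi (s *: x + b)).
Proof.
move=> [cp dp cdp]; split.
- by move=> x; apply: continuous_comp; [exact: continuous_affine|exact: cp].
- by move=> i x; exact: (derive_affine s b x (dp i)).1.
- move=> i.
  have -> : (fun x => 'D_(Defs.basis i) (fun x => phi (s *: x + b)) x) =
     (fun x => s * 'D_(Defs.basis i) phi (s *: x + b)).
    by apply/funext => x; rewrite (derive_affine s b x (dp i)).2.
  move=> x; apply: (@continuousM R E (cst s) (fun x => 'D_(Defs.basis i) phi (s *: x + b))).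
    exact: cst_continuous.
  have : {for x, continuous ((fun y => 'D_(Defs.basis i) phi y) \o (fun y => s *: y + b))}.
    apply: continuous_comp; [exact: continuous_affine|exact: cdp].
  exact.
Qed.

Lemma C1_integral_line (phi : E -> R) i (x : E) (h : R) : C1 phi -> 0 < h ->
  (\int[@lebesgue_measure R]_s ('D_(Defs.basis i) phi (x - s *: Defs.basis i) * \1_(`[0%R, h]%classic) s)%:E
   = (phi x - phi (x - h *: Defs.basis i))%:E)%E.
Proof.
move=> [cp dp cdp] h0.
set e := Defs.basis i.
pose psi t := phi (x + t *: e).
have dF t : 0 <= t <= h -> is_derive t 1 (- (psi \o -%R)) ('D_e phi (x - t *: e)).
  move=> _; have dl := is_derive_line (dp i (x + (- t) *: e)).
  have dn : is_derive t 1 (-%R : R -> R) (- 1) by exact: is_deriveN.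
  have dc := is_derive1_comp dl dn.
  by have := is_deriveN dc; rewrite mulrN1 opprK scaleNr.
have cD : {within `[0, h], continuous (fun t => 'D_e phi (x - t *: e))}.
  apply: continuous_in_subspaceT => t _.
  have : {for t, continuous ((fun y => 'D_e phi y) \o (fun t => x - t *: e))}.
    apply: continuous_comp; last exact: cdp.
    apply: (@continuousD _ _ _ (cst x) (fun t : R => - (t *: e))); first exact: cst_continuous.
    by apply: continuousN; exact: scalel_continuous.
  exact.
transitivity (\int[lebesgue_measure]_(s in `[0%R, h]) ('D_e phi (x - s *: e))%:E)%E.
  rewrite [RHS]integral_mkcond; apply: eq_integral => s _.
  by rewrite patchE indicE; case: ifPn; rewrite ?mulr1 ?mulr0.
rewrite (integral_is_derive h0 dF cD) !fctE /psi /= oppr0 scale0r addr0 scaleNr.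
by rewrite opprK addrC.
Qed.

End C1_functions.

Section averages.
Context {R : realType} {N : nat}.
Local Notation E := 'rV[R]_N.
Local Notation mR := (measurableTypeR R).
Local Notation mu := (lebesgueN R N).
Local Notation leb := (@lebesgue_measure R).

Lemma box_add (a b : R) (x y : E) : box a x -> `|y| <= b -> box (a + b) (x + y).
Proof.
move=> xa yb i; rewrite mxE; apply: le_trans (ler_normD _ _) (lerD (xa i) _).
by have := rV_norm_le y (le_trans (normr_ge0 y) yb); rewrite yb => /esym/forallP.
Qed.

Let leb_segment_lty (h : R) : (leb `[0%R, h]%classic < +oo)%E.
Proof. by rewrite lebesgue_measure_itv/=; case: ifPn => // _; rewrite -EFinB ltry. Qed.

Lemma integrable_slab (F : E * mR -> R) (M r h : R) :
  measurable_fun [set: E * mR] F -> (forall z, `|F z| <= M) ->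
  (forall z, F z != 0 -> box r z.1 /\ `[0, h]%classic z.2) ->
  (mu \x leb)%E.-integrable [set: E * mR] (EFin \o F).
Proof.
move=> mF FM Fs.
pose D : set (E * mR) := box r `*` `[0, h]%classic.
have M0 : 0 <= M by exact: le_trans (FM (0, 0)).
have mD : measurable D by apply: measurableX => //; exact: measurable_box.
apply: (@le_integrable _ _ _ _ _ measurableT _ (fun z => M%:E * (\1_D z)%:E)%E).
- exact/measurable_EFinP.
- move=> z _ /=; rewrite lee_fin normrM (ger0_norm M0).
  have [->|/Fs[z1 z2]] := eqVneq (F z) 0; first by rewrite normr0 mulr_ge0.
  by rewrite indicE mem_set ?normr1 ?mulr1//; split.
- apply: integrableZl => //.
  apply/integrableP; split; first by apply/measurable_EFinP; exact: measurable_indic.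
  under eq_integral do rewrite gee0_abs ?lee_fin//.
  rewrite integral_indic// setIT.
  rewrite [ltLHS](_ : _ = (mu (box r) * leb `[0%R, h]%classic)%E); last first.
    by apply: product_measure1E => //; exact: measurable_box.
  rewrite lte_mul_pinfty ?ge0_fin_numE ?lebesgueN_box_lty//.
Qed.

(** Justifies Fubini's theorem for averages. The two directions cover the integrand both before the
    translation ([v = e], [w = 0]) and after it ([v = 0], [w = - e]). *)
Lemma slab_product (a b : E -> R) (v w : E) (h : R) : bcs a -> locally_bounded_mfun b ->
  (mu \x leb)%E.-integrable [set: E * mR]
   (fun z => (a (z.1 + z.2 *: v) * b (z.1 + z.2 *: w) * \1_(`[0%R, h]%classic) z.2)%:E).
Proof.
move=> [ma [B [aB ar]]] [mb bC].
(* Where the factor [a] is nonzero, [z.1] is within [h * |v|] of [box B]; adding [z.2 *: w] moves it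
   by at most [h * |w|] more. *)
have [C {}bC] := bC (B + h * `|v| + h * `|w|).
have B0 : 0 <= B by exact: le_trans (aB 0).
have key (z : E * mR) : a (z.1 + z.2 *: v) * b (z.1 + z.2 *: w) * \1_(`[0, h]%classic) z.2 != 0 ->
    [/\ box (B + h * `|v|) z.1, `[0, h]%classic z.2 & `|b (z.1 + z.2 *: w)| <= C].
  rewrite !mulf_eq0 !negb_or => /andP[/andP[/ar a0 _]].
  rewrite indicE; case: (boolP (z.2 \in _)); rewrite ?eqxx// => /set_mem zh _.
  have := zh; rewrite /= in_itv/= => /andP[z0 z2].
  have zb : box (B + h * `|v|) z.1.
    rewrite -(addrK (z.2 *: v) z.1); apply: box_add => //.
    by rewrite normrN normrZ ger0_norm// ler_wpM2r.
  split => //; apply: bC; apply: box_add => //.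
  by rewrite normrZ ger0_norm// ler_wpM2r.
apply: (@integrable_slab _ (B * `|C|) (B + h * `|v|) h).
- apply: measurable_funM; last exact: (measurableT_comp (measurable_indic _) measurable_snd).
  by apply: measurable_funM; [apply: (measurableT_comp ma)|apply: (measurableT_comp mb)]; exact: measurable_line.
- move=> z; set t := (X in `|X| <= _).
  have [->|/key[_ _ bb]] := eqVneq t 0; first by rewrite normr0 mulr_ge0.
  rewrite /t !normrM indicE -[leRHS]mulr1 ler_pM//.
    by rewrite ler_pM// (le_trans bb)// ler_norm.
  by rewrite normr_nat lern1 leq_b1.
- by move=> z /key[].
Qed.

Lemma line_integrable (f : E -> R) (e x : E) (h : R) : locally_bounded_mfun f ->
  leb.-integrable [set: mR] (fun s => (f (x + s *: e) * \1_(`[0%R, h]%classic) s)%:E).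
Proof.
move=> [mf bf]; have [C {}bf] := bf (`|x| + h * `|e|).
have ml : measurable_fun [set: mR] (fun s => f (x + s *: e)).
  apply: (measurableT_comp mf).
  apply: (@measurableT_comp _ _ _ _ _ _ (fun z : E * mR => z.1 + z.2 *: e) _ (fun s => (x, s))).
    exact: measurable_line.
  exact: measurable_pair1.
apply: (@le_integrable _ _ _ _ _ measurableT _ (fun s => `|C|%:E * (\1_(`[0%R, h]%classic : set mR) s)%:E)%E).
- by apply/measurable_EFinP/measurable_funM => //; exact: measurable_indic.
- move=> s _ /=; rewrite lee_fin !normrM normr_id indicE.
  case: (boolP (s \in _)) => [/set_mem|_]; last by rewrite normr0 !mulr0.
  rewrite /= in_itv/= => /andP[s0 sh]; rewrite normr1 !mulr1.
  apply: le_trans (ler_norm C); apply: bf; apply: box_add.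
    by move=> i; have := rV_norm_le x (normr_ge0 x); rewrite lexx => /esym/forallP.
  by rewrite normrZ ger0_norm// ler_wpM2r.
- apply: integrableZl => //.
  apply/integrableP; split; first by apply/measurable_EFinP; exact: measurable_indic.
  under eq_integral do rewrite gee0_abs ?lee_fin//.
  rewrite integral_indic// setIT.
  exact: leb_segment_lty.
Qed.

(** The mean of [f] over the segment from [x] to [x + h *: e]. The indicator keeps the integral on
    the whole line, ready for Fubini and translations. *)
Definition avg (e : E) (h : R) (f : E -> R) (x : E) : R :=
  h^-1 * \int[leb]_s (f (x + s *: e) * \1_(`[0, h]%classic) s).

Lemma avgE e h f x : bcs f ->
  ((avg e h f x)%:E = h^-1%:E * \int[leb]_s (f (x + s *: e)%R * \1_(`[0%R, h]%classic) s)%:E)%E.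
Proof.
move=> bf; rewrite /avg EFinM /Rintegral fineK//.
apply: integrable_fin_num => //; exact/line_integrable/bcs_locally_bounded.
Qed.

(** The constant is uniform in [h], which provides the dominating function when [h] tends to 0: the
    bound of [f] is kept, and the support moves by at most [|e|]. *)
Lemma avg_bound e f : bcs f -> exists C, forall h, 0 < h <= 1 -> forall x,
  `|avg e h f x| <= C /\ (avg e h f x != 0 -> box C x).
Proof.
move=> bf; have [mf [B [fB fr]]] := bf.
have B0 : 0 <= B by exact: le_trans (fB 0).
exists (B + `|e|) => h /andP[h0 h1] x; split; last first.
  move=> ax; apply: contrapT => xb.
  move/negP : ax; apply; apply/eqP; rewrite /avg.
  rewrite (_ : \int[_]_s _ = 0) ?mulr0//.
  apply/eqP; rewrite /Rintegral integral0_eq// => s _; congr EFin.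
  rewrite indicE; case: (boolP (s \in _)); last by rewrite mulr0.
  move=> /set_mem; rewrite /= in_itv/= => /andP[s0 sh].
  have [->|/fr bx] := eqVneq (f (x + s *: e)) 0; first by rewrite mul0r.
  exfalso; apply: xb.
  rewrite -(addrK (s *: e) x); apply: box_add => //.
  by rewrite normrN normrZ ger0_norm// ler_piMl// (le_trans sh).
apply: (@le_trans _ _ B); last by rewrite lerDl.
rewrite /avg normrM ger0_norm ?invr_ge0 ?(ltW h0)// ler_pdivrMl//.
apply: le_trans (le_normr_Rintegral _ _) _ => //.
  exact/line_integrable/bcs_locally_bounded.
rewrite -lee_fin /Rintegral fineK; last first.
  apply: integrable_fin_num => //.
  have := integrable_abse (line_integrable e x h (bcs_locally_bounded bf)).
  by [].
apply: (@le_trans _ _ (\int[leb]_s (B%:E * (\1_(`[0%R, h]%classic : set mR) s)%:E))%E).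
  apply: ge0_le_integral => //.
  - apply/measurable_EFinP/measurableT_comp => //; apply/measurable_EFinP.
    exact: measurable_int (line_integrable e x h (bcs_locally_bounded bf)).
  - by apply: measurable_funeM; apply/measurable_EFinP; exact: measurable_indic.
  - move=> s _; rewrite -EFinM lee_fin normrM [X in _ * X]ger0_norm// ler_wpM2r//.
rewrite ge0_integralZl_EFin//; last by apply/measurable_EFinP; exact: measurable_indic.
rewrite integral_indic// setIT.
have lebh : leb `[0%R, h]%classic = h%:E by rewrite lebesgue_measure_itv/= lte_fin h0 -EFinB subr0.
by rewrite [X in (_ * X)%E]lebh -EFinM mulrC.
Qed.

Lemma bcs_avg e h f : 0 < h <= 1 -> bcs f -> bcs (avg e h f).
Proof.
move=> hh bf; have [C hC] := avg_bound e bf.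
split; last by exists C; split => x; have [] := hC h hh x.
apply/measurable_EFinP.
rewrite (_ : _ \o _ = (fun x => h^-1%:E * \int[leb]_s (f (x + s *: e)%R * \1_(`[0%R, h]%classic) s)%:E)%E); last first.
  by apply/funext => x /=; rewrite avgE.
apply: measurable_funeM.
have lb1 : locally_bounded_mfun (cst 1 : E -> R).
  by split => // r; exists 1 => x _; rewrite normr1.
have := measurable_fubini_F (slab_product e 0 h bf lb1).
congr measurable_fun; apply/funext => x; apply: eq_integral => s _ /=.
by rewrite mulr1.
Qed.

(** By Fubini's theorem and the translation [x := x - s *: e], averaging is transferred from [f] to
    the test factor [psi]. *)
Lemma integral_avg_mul e h f (psi : E -> R) : bcs f -> locally_bounded_mfun psi ->
  (\int[mu]_x (avg e h f x * psi x)%:E = h^-1%:E *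
   \int[leb]_s \int[mu]_x (f x * psi (x - s *: e)%R * \1_(`[0%R, h]%classic) s)%:E)%E.
Proof.
move=> bf lpsi; have mf := bcs_measurable bf; have mpsi := lpsi.1.
pose F (z : E * mR) := (f (z.1 + z.2 *: e) * psi (z.1 + z.2 *: 0) * \1_(`[0%R, h]%classic) z.2)%:E.
have iF : (mu \x leb)%E.-integrable [set: E * mR] F by exact: slab_product.
transitivity (\int[mu]_x (h^-1%:E * \int[leb]_s F (x, s)))%E.
  apply: eq_integral => x _; rewrite EFinM avgE// -muleA; congr (_ * _)%E.
  rewrite muleC -integralZl//; last exact/line_integrable/bcs_locally_bounded.
  by apply: eq_integral => s _; rewrite /F /= scaler0 addr0 -EFinM mulrA [psi x * _]mulrC.
rewrite integralZl//; last exact: integrable_fubini_F.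
congr (_ * _)%E; rewrite (Fubini iF); apply: eq_integral => s _.
have mT : measurable_fun [set: E] (fun x => (f x * psi (x - s *: e) * \1_(`[0%R, h]%classic) s)%:E).
  apply/measurable_EFinP/measurable_funM => //; apply: measurable_funM => //.
  apply: (measurableT_comp mpsi); exact: measurable_shift.
rewrite -(integral_translate (s *: e) mT); apply: eq_integral => x _.
by rewrite /F /= scaler0 addr0 addrK.
Qed.

(* Stronger than [weak_gradient]: test functions are merely C^1 and need no
   compact support, which is harmless as [v] and [g] will have one. *)
Definition has_weak_derivative (i : 'I_N) (v g : E -> R) := forall phi, C1 phi ->
  (\int[mu]_x (v x * 'D_(Defs.basis i) phi x)%:E = - \int[mu]_x (g x * phi x)%:E)%E.

Lemma C1_locally_bounded (phi : E -> R) : C1 phi -> locally_bounded_mfun phi.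
Proof. by move=> [cp _ _]; exact: continuous_locally_bounded. Qed.

Lemma C1_derive_locally_bounded (phi : E -> R) i : C1 phi ->
  locally_bounded_mfun (fun x => 'D_(Defs.basis i) phi x).
Proof. by move=> [_ _ cdp]; exact: continuous_locally_bounded. Qed.

Lemma derive_translate (phi : E -> R) i (b x : E) : C1 phi ->
  'D_(Defs.basis i) (fun x => phi (x + b)) x = 'D_(Defs.basis i) phi (x + b).
Proof.
move=> [_ dp _].
have -> : (fun x => phi (x + b)) = (fun x => phi (1 *: x + b)).
  by apply/funext => y; rewrite (scale1r y).
by rewrite (derive_affine 1 b x (dp i)).2 (scale1r x) [LHS]mul1r.
Qed.

Lemma C1_shift (phi : E -> R) (b : E) : C1 phi -> C1 (fun x => phi (x + b)).
Proof.
move=> /(C1_affine 1 b); congr C1.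
by apply/funext => y; rewrite scale1r.
Qed.

End averages.

Section weak_derivatives_of_averages.
Context {R : realType} {N : nat}.
Local Notation E := 'rV[R]_N.
Local Notation mR := (measurableTypeR R).
Local Notation mu := (lebesgueN R N).
Local Notation leb := (@lebesgue_measure R).

Lemma avgN e h (f : E -> R) x : bcs f -> avg e h (fun x => - f x) x = - avg e h f x.
Proof.
move=> bf; apply/EFin_inj; rewrite EFinN !avgE//; last first.
  by have := bcsZ (-1) bf; congr bcs; apply/funext => y; rewrite mulN1r.
rewrite -muleN; congr (_ * _)%E; rewrite -mulN1e -integralZl//; last exact/line_integrable/bcs_locally_bounded.
by apply: eq_integral => s _; rewrite -EFinM mulNr mulN1r.
Qed.

(** Averaging commutes with weak derivatives: once it is transferred to [phi], the hypothesis
    applies for each [s] to a translate of [phi]. Thus later averagings do not destroy earlier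
    derivatives. *)
Lemma has_weak_derivative_avg i e h (f g : E -> R) : 0 < h <= 1 -> bcs f -> bcs g ->
  has_weak_derivative i f g -> has_weak_derivative i (avg e h f) (avg e h g).
Proof.
move=> h01 bf bg fg phi cphi.
have bNg : bcs (fun x => - g x).
  by have := bcsZ (-1) bg; congr bcs; apply/funext => y; rewrite mulN1r.
have lphi := C1_locally_bounded cphi.
have ldphi := C1_derive_locally_bounded i cphi.
transitivity (\int[mu]_x (avg e h (fun x => - g x) x * phi x)%:E)%E; last first.
  rewrite -mulN1e -bcs_integralZl; last exact/bcsM/lphi/bcs_avg.
  by apply: eq_integral => x _; rewrite avgN// mulNr mulN1r.
rewrite (integral_avg_mul e h bf ldphi) (integral_avg_mul e h bNg lphi); congr (_ * _)%E; apply: eq_integral => s _.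
rewrite indicE; case: (s \in _); last first.
  by under eq_integral do rewrite mulr0; under [RHS]eq_integral do rewrite mulr0.
under eq_integral do rewrite mulr1; under [RHS]eq_integral do rewrite mulr1.
have c1 := C1_shift (- (s *: e)) cphi.
transitivity (- \int[mu]_x (g x * phi (x - s *: e)%R)%:E)%E.
  by rewrite -(fg _ c1); apply: eq_integral => x _; rewrite (@derive_translate R N phi i (- (s *: e)) x cphi).
rewrite -mulN1e -bcs_integralZl; last exact/bcsM/C1_locally_bounded/c1.
by apply: eq_integral => x _; rewrite mulN1r mulNr.
Qed.

(** After the transfer to the test function, its derivative is integrated along the segment, which
    leaves an increment of [phi] by the fundamental theorem of calculus. *)
Lemma avg_has_weak_derivative i h (f : E -> R) : 0 < h <= 1 -> bcs f ->
  has_weak_derivative i (avg (Defs.basis i) h f)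
    (fun x => h^-1 * (f (x + h *: Defs.basis i) - f x)).
Proof.
move=> /andP[h0 h1] bf phi cphi.
set e := Defs.basis i.
have lphi := C1_locally_bounded cphi.
have ldphi := C1_derive_locally_bounded i cphi.
have lphih := C1_locally_bounded (C1_shift (- (h *: e)) cphi).
rewrite (integral_avg_mul e h bf ldphi).
have iF := slab_product 0 (- e) h bf ldphi.
have fE x s : (f x * 'D_e phi (x - s *: e) * \1_(`[0, h]%classic) s)%:E =
    (f (x + s *: 0) * 'D_e phi (x + s *: - e) * \1_(`[0, h]%classic) s)%:E.
  by rewrite scaler0 addr0 scalerN.
under eq_integral => s _ do under eq_integral => x _ do rewrite fE.
rewrite -(Fubini iF).
have bfphi : bcs (fun x => f x * phi x) by exact: bcsM.
have bfphih : bcs (fun x => f x * phi (x - h *: e)) by exact: bcsM.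
transitivity (h^-1%:E * \int[mu]_x (f x * phi x - f x * phi (x - h *: e)%R)%:E)%E.
  congr (_ * _)%E; apply: eq_integral => x _.
  transitivity ((f x)%:E * \int[leb]_s ('D_e phi (x - s *: e)%R * \1_(`[0%R, h]%classic) s)%:E)%E.
    rewrite -integralZl//.
      by apply: eq_integral => s _; rewrite -fE -EFinM mulrA.
    have := line_integrable (- e) x h ldphi.
    by under eq_fun do rewrite scalerN.
  by rewrite C1_integral_line// -EFinM mulrBr.
have bfh : bcs (fun x => f (x + h *: e)).
  by have := bcs_affine (h *: e) (oner_neq0 R) bf; congr bcs; apply/funext => x; rewrite scale1r.
have bfhphi : bcs (fun x => f (x + h *: e) * phi x) by exact: bcsM.
(* Summation by parts: translating by [h *: e] moves the increment from [phi] to [f]. *)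
have -> : (\int[mu]_x (f x * phi x - f x * phi (x - h *: e)%R)%:E =
  \int[mu]_x (f x * phi x)%:E - \int[mu]_x (f (x + h *: e)%R * phi x)%:E)%E.
  rewrite integralB_EFin//; [|exact: bcs_integrable|exact: bcs_integrable].
  congr (_ - _)%E.
  have mT : measurable_fun [set: E] (fun x => (f x * phi (x - h *: e))%:E).
    by apply/measurable_EFinP; case: bfphih.
  rewrite -(integral_translate (h *: e) mT); apply: eq_integral => x _.
  by rewrite addrK.
transitivity (- \int[mu]_x (h^-1 * (f (x + h *: e)%R * phi x - f x * phi x))%:E)%E; last first.
  by congr (- _)%E; apply: eq_integral => x _; rewrite -mulrA mulrBl.
rewrite bcs_integralZl; last first.
  have := bcsD bfhphi (bcsZ (-1) bfphi); congr bcs; apply/funext => x.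
  by rewrite mulN1r.
rewrite integralB_EFin//; [|exact: bcs_integrable|exact: bcs_integrable].
have finphi : (\int[mu]_x (f x * phi x)%:E)%E \is a fin_num.
  by apply: integrable_fin_num => //; exact: bcs_integrable.
move: finphi; set a := (\int[mu]_x (f x * phi x)%:E)%E.
set b := (\int[mu]_x (f (x + h *: e)%R * phi x)%:E)%E => finphi.
by rewrite -muleN (fin_num_oppeB b finphi) [X in (_ * X)%E]addeC.
Qed.

End weak_derivatives_of_averages.

Section averages_convergence.
Context {R : realType} {N : nat}.
Local Notation E := 'rV[R]_N.
Local Notation mR := (measurableTypeR R).
Local Notation mu := (lebesgueN R N).
Local Notation leb := (@lebesgue_measure R).

Let harm (k : nat) : R := k.+1%:R^-1.

Let harm01 k : 0 < harm k <= 1.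
Proof. by rewrite invr_gt0 ltr0n/= invf_le1 ?ltr0n// ler1n. Qed.

Lemma cvg_avg_line (e : E) (f : E -> R) (x : E) : bcs f ->
  {ae leb, forall s, 0 <= s <= 1 ->
    avg e (harm k) f (x + s *: e) @[k --> \oo] --> f (x + s *: e)}.
Proof.
move=> bf.
(* The cutoff to [[0, 2]] makes the restriction to the line integrable and is invisible here:
   [s <= 1] and [r <= harm k <= 1] give [r + s <= 2]. *)
have iF := line_integrable e x 2 (bcs_locally_bounded bf).
have := ae_cvg_right_average iF.
apply: filterS; first exact: (ae_filter_ringOfSetsType leb).
move=> s cs /andP[s0 s1].
have FE t : 0 <= t <= 2 -> f (x + t *: e) * \1_(`[0, 2]%classic) t = f (x + t *: e).
  by move=> t02; rewrite indicE mem_set ?mulr1//= in_itv.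
move: cs; rewrite FE; last by rewrite s0 (le_trans s1)// ler1n.
apply: cvg_trans; apply: near_eq_cvg; apply: nearW => k.
rewrite /avg invrK; congr (_ * _); apply: eq_Rintegral => r _.
rewrite -/(harm k) !(indicE _ `[0, harm k]%classic).
case: (boolP (r \in `[0, harm k]%classic)) => [/set_mem|_]; last by rewrite !mulr0.
rewrite /= in_itv/= => /andP[r0 r1].
rewrite FE ?addr_ge0//=.
  by rewrite !mulr1 [r + s]addrC scalerDl addrA.
by rewrite -[2]/(1 + 1) lerD// (le_trans r1)//; have /andP[] := harm01 k.
Qed.

(* On each line the convergence is one-dimensional Lebesgue differentiation;
   Tonelli and translation invariance transfer it to R^N. *)
Lemma ae_cvg_avg (e : E) (f : E -> R) : bcs f ->
  {ae mu, forall x, avg e (harm k) f x @[k --> \oo] --> f x}.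
Proof.
move=> bf.
pose u k x := (`|avg e (harm k) f x - f x|)%:E.
have mu_ k : measurable_fun [set: E] (u k).
  apply/measurable_EFinP/measurableT_comp => //; apply: measurable_funB.
    by apply: bcs_measurable; exact: bcs_avg (harm01 k) bf.
  exact: bcs_measurable.
(* The superior limit of the errors is measurable and vanishes exactly at the points of convergence,
   so the exceptional set [Z] is measurable. *)
pose L x := limn_esup (u ^~ x).
have mL : measurable_fun [set: E] L by exact: measurable_fun_limn_esup.
pose Z := [set x | L x != 0%E].
have mZ : measurable Z.
  rewrite -[Z]setTI; exact: emeasurable_neq.
have cvgP x : (u ^~ x @ \oo --> 0%E) <-> (avg e (harm k) f x @[k --> \oo] --> f x).
  split=> [/fine_cvgP[_ c0]|cx].
    by apply/subr_cvg0; exact: (norm_cvg0P _).1 c0.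
  apply/fine_cvgP; split; first exact: nearW.
  by apply: (norm_cvg0P _).2; apply/subr_cvg0.
have ZP x : ~ Z x -> avg e (harm k) f x @[k --> \oo] --> f x.
  move/negP; rewrite negbK => /eqP Lx0; apply/cvgP.
  by apply: limn_esup_le_cvg; [rewrite -/(L x) Lx0|move=> k; rewrite lee_fin].
have PZ x : avg e (harm k) f x @[k --> \oo] --> f x -> ~ Z x.
  move=> /cvgP cx; apply/negP; rewrite negbK; apply/eqP.
  by rewrite /L (cvg_limn_einf_sup cx).2.
exists Z; split => //; last by move=> x /= h; apply: contrapT => /ZP.
(* Integrating first in [s] gives 0 on each line; integrating first in [x] gives [mu Z] times the
   length 1 of the segment. *)
pose F (z : E * mR) : \bar R := ((\1_Z (z.1 + z.2 *: e) : R) * \1_(`[0%R, 1%R]%classic) z.2)%:E.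
have mF : measurable_fun [set: E * mR] F.
  apply/measurable_EFinP/measurable_funM.
    apply: (measurableT_comp (measurable_indic mZ)); exact: measurable_line.
  exact: (measurableT_comp (measurable_indic _) measurable_snd).
have F0 z : (0 <= F z)%E by rewrite lee_fin mulr_ge0.
have lhs : (\int[mu]_x \int[leb]_s F (x, s) = 0)%E.
  rewrite integral0_eq// => x _.
  rewrite -[RHS](@integral0 _ _ _ leb setT).
  apply: ae_eq_integral => //.
    by apply: (measurableT_comp mF); exact: measurable_pair1.
  have := cvg_avg_line e x bf.
  apply: filterS; first exact: (ae_filter_ringOfSetsType leb).
  move=> s cs _; rewrite /F /= !indicE.
  case: (boolP (s \in `[0%R, 1%R]%classic)) => [/set_mem|_]; last by rewrite mulr0.
  rewrite /= in_itv/= => /cs/PZ nZ.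
  by rewrite memNset// mul0r.
have := @fubini_tonelli _ _ _ _ _ mu leb F mF F0; rewrite lhs => /esym.
have rhs s : (\int[mu]_x F (x, s) = mu Z * (\1_(`[0%R, 1%R]%classic : set R) s)%:E)%E.
  have m1 : measurable_fun [set: E] (fun x => (\1_Z x : R)%:E).
    by apply/measurable_EFinP; exact: measurable_indic.
  rewrite muleC.
  transitivity ((\1_(`[0%R, 1%R]%classic : set R) s)%:E * \int[mu]_x (\1_Z x : R)%:E)%E.
    rewrite -(integral_translate (s *: e) m1) -ge0_integralZl_EFin//.
      by apply: eq_integral => x _; rewrite /F /= EFinM muleC.
    by apply: (measurableT_comp m1); exact: measurable_shift.
  by rewrite integral_indic// setIT.
under eq_integral do rewrite rhs.
rewrite ge0_integralZl//; last by apply/measurable_EFinP; exact: measurable_indic.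
rewrite integral_indic// setIT.
have leb1 : leb `[0%R, 1%R]%classic = 1%E by rewrite lebesgue_measure_itv/= lte_fin ltr01 -EFinB subr0.
by rewrite [X in (_ * X)%E]leb1 mule1.
Qed.

End averages_convergence.

(** * Approximate minimizers *)

Section approximation.
Context {R : realType} {N : nat}.
Local Notation E := 'rV[R]_N.
Local Notation mu := (lebesgueN R N).

Lemma bcs_sqr (v : E -> R) : bcs v -> bcs (fun x => `|v x| ^+ 2).
Proof.
move=> bv; apply: (bcs_comp (h := fun t => `|t| ^+ 2) bv).
- by apply: measurable_funX; exact: normr_measurable.
- by rewrite normr0 expr0n.
- move=> B; exists (B ^+ 2) => t tB; rewrite normrX normr_id.
  by rewrite lerXn2r ?nnegrE// (le_trans _ tB).
Qed.

Lemma L2_measurable (u : E -> R) : L2 u -> measurable_fun [set: E] u.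
Proof. by rewrite /L2 => /sub_Lfun_mfun; rewrite inE. Qed.

Lemma bcs_L2 (v : E -> R) : bcs v -> L2 v.
Proof.
move=> bv; rewrite /L2 inE; apply/andP; split; rewrite inE/=; first exact: bcs_measurable.
rewrite /finite_norm unlock poweR_lty//.
have /integrableP[_] := bcs_integrable (bcs_sqr bv).
apply: le_lt_trans; rewrite le_eqVlt; apply/orP; left; apply/eqP.
apply: eq_integral => x _; rewrite -[LHS]/((`|v x|)%:E `^ 2)%E.
by rewrite poweR_EFin powR_mulrn// gee0_abs// lee_fin exprn_ge0.
Qed.

Lemma lt_limn_einf (u : nat -> \bar R) (d : \bar R) :
  (d < limn_einf u)%E -> \forall k \near \oo, (d < u k)%E.
Proof.
move=> du; have [n dn] : exists n, (d < einfs u n)%E.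
  apply: contrapT => /forallNP h; move: du; apply/negP; rewrite -leNgt.
  rewrite limn_einf_lim; apply: lime_le; first exact: is_cvg_einfs.
  by apply: nearW => n; rewrite leNgt; apply/negP; exact: h.
exists n => // k /= nk; apply: (lt_le_trans dn).
by apply: ereal_inf_lbound; exists k.
Qed.

Variables (alpha : R).
Hypotheses (N_ge1 : (1 <= N)%N) (alpha_gt0 : 0 < alpha) (alpha_ltN : alpha < N%:R).

Definition sqnorm (v : E -> R) : \bar R := (\int[mu]_x (`|v x| ^+ 2)%:E)%E.

(** Both bounds are strict, hence open conditions, so they survive one averaging with small [h] and
    then the next ones. *)
Lemma avg_step i (v : E -> R) (d c : \bar R) : bcs v ->
  (d < choquard alpha v)%E -> (sqnorm v < c)%E ->
  exists h, [/\ 0 < h <= 1, (d < choquard alpha (avg (Defs.basis i) h v))%E &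
    (sqnorm (avg (Defs.basis i) h v) < c)%E].
Proof.
move=> bv dv vc; set e := Defs.basis i.
pose h (k : nat) : R := k.+1%:R^-1.
have h01 k : 0 < h k <= 1.
  by rewrite invr_gt0 ltr0n/= invf_le1 ?ltr0n// ler1n.
have cvg := ae_cvg_avg e bv.
have bavg k : bcs (avg e (h k) v) by exact: bcs_avg.
have near1 : \forall k \near \oo, (d < choquard alpha (avg e (h k) v))%E.
  apply: lt_limn_einf; apply: (lt_le_trans dv).
  by apply: choquard_fatou => // [k|]; exact: bcs_measurable.
have [C hC] := avg_bound e bv.
have C0 : 0 <= C by exact: le_trans (hC (h 0) (h01 0) 0).1.
have near2 : \forall k \near \oo, (sqnorm (avg e (h k) v) < c)%E.
  have [] := @dominated_convergence _ _ _ mu setT measurableT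
    (fun k x => (`|avg e (h k) v x| ^+ 2)%:E) (fun x => (`|v x| ^+ 2)%:E)
    (fun x => (C ^+ 2 * \1_(box C) x)%:E).
  - by move=> k; apply/measurable_EFinP; exact: bcs_measurable (bcs_sqr (bavg k)).
  - by apply/measurable_EFinP; exact: bcs_measurable (bcs_sqr bv).
  - apply: filterS cvg => x cx _; apply: cvg_EFin; first exact: nearW.
    exact: (cvgM (cvg_norm cx) (cvg_norm cx)).
  - exact/bcs_integrable/bcsZ/bcs_indic_box.
  - apply: nearW => x k _ /=; rewrite lee_fin ger0_norm ?exprn_ge0//.
    have [ax xb] := hC (h k) (h01 k) x.
    have [->|/xb bx] := eqVneq (avg e (h k) v x) 0.
      by rewrite normr0 expr0n mulr_ge0// exprn_ge0.
    by rewrite indicE mem_set// mulr1 lerXn2r ?nnegrE.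
  - move=> _ _ /(_ [set y | (y < c)%E]); apply.
    exact: open_ereal_lt'.
have [k [dk kc]] := filter_ex (filterI near1 near2).
by exists (h k).
Qed.

Lemma bcs_diff_quotient (b : E) (h : R) (v : E -> R) : bcs v ->
  bcs (fun x => h^-1 * (v (x + h *: b) - v x)).
Proof.
move=> bv; apply: bcsZ.
have bvh : bcs (fun x => v (x + h *: b)).
  by have := bcs_affine (h *: b) (oner_neq0 R) bv; congr bcs; apply/funext => x; rewrite scale1r.
have := bcsD bvh (bcsZ (-1) bv); congr bcs; apply/funext => x.
by rewrite mulN1r.
Qed.

Lemma approx_weak_derivative (s : seq 'I_N) (v : E -> R) (d c : \bar R) : bcs v ->
  (d < choquard alpha v)%E -> (sqnorm v < c)%E ->
  exists v', [/\ bcs v', (d < choquard alpha v')%E, (sqnorm v' < c)%E &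
    forall i, i \in s -> exists2 g, bcs g & has_weak_derivative i v' g].
Proof.
move=> bv dv vc; elim: s => [|i s [w [bw dw wc ws]]]; first by exists v.
have [h [h01 dh hc]] := avg_step i bw dw wc.
exists (avg (Defs.basis i) h w); split => //; first exact: bcs_avg.
move=> j; rewrite inE => /predU1P[->|/ws[g bg wg]].
  exists (fun x => h^-1 * (w (x + h *: Defs.basis i) - w x)).
    exact: bcs_diff_quotient.
  exact: avg_has_weak_derivative.
exists (avg (Defs.basis i) h g); first exact: bcs_avg.
exact: has_weak_derivative_avg.
Qed.

Definition nice (v : E -> R) (g : E -> E) := [/\ bcs v, forall i, bcs (fun x => g x 0 i)
  & forall i, has_weak_derivative i v (fun x => g x 0 i)].

Lemma nice_approx (v : E -> R) (d c : \bar R) : bcs v ->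
  (d < choquard alpha v)%E -> (sqnorm v < c)%E ->
  exists w g, [/\ nice w g, (d < choquard alpha w)%E & (sqnorm w < c)%E].
Proof.
move=> bv dv vc.
have [w [bw dw wc ws]] := approx_weak_derivative (enum 'I_N) bv dv vc.
have /choice[g gw] : forall i, exists g, bcs g /\ has_weak_derivative i w g.
  by move=> i; have [|g bg wg] := ws i; [rewrite mem_enum|exists g].
exists w, (fun x => \row_i g i x); split => //; split => // i.
  by have := (gw i).1; congr bcs; apply/funext => x; rewrite mxE.
by have := (gw i).2; congr has_weak_derivative; apply/funext => x; rewrite mxE.
Qed.

Lemma truncation_approx (u : E -> R) (d c : \bar R) : measurable_fun [set: E] u ->
  (d < choquard alpha u)%E -> (sqnorm u < c)%E ->
  exists v, [/\ bcs v, (d < choquard alpha v)%E & (sqnorm v < c)%E].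
Proof.
move=> mu' du uc.
(* Truncating [|u|] instead of [u] is harmless, both functionals depending on [|u|] only. At each
   point the sequence is eventually equal to [|u x|]. *)
pose v (k : nat) x := Num.min `|u x| k%:R * \1_(box k%:R) x.
have mv k : measurable_fun [set: E] (v k).
  apply: measurable_funM; last by apply: measurable_indic; exact: measurable_box.
  by apply: measurable_minr => //; exact: measurableT_comp.
have vb k x : 0 <= v k x <= Num.min `|u x| k%:R.
  have m0 : 0 <= Num.min `|u x| k%:R by rewrite le_min normr_ge0 ler0n.
  by rewrite /v mulr_ge0//= ler_piMr// indicE lern1 leq_b1.
have bv k : bcs (v k).
  apply: (@bcsI _ _ _ k%:R k%:R) => // x; have /andP[v0 vm] := vb k x.
    by rewrite ger0_norm// (le_trans vm)// ge_min lexx orbT.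
  rewrite /v; case: (boolP (x \in box k%:R)) => [/set_mem//|xk].
  by rewrite indicE (negbTE xk) mulr0 eqxx.
have cv x : v k x @[k --> \oo] --> `|u x|.
  apply: cvg_near_cst; exists (Num.trunc (`|x| + `|u x|)).+1 => // k /= hk.
  have hk' : `|x| + `|u x| <= k%:R.
    by apply: le_trans (ltW (truncnS_gt _)) _; rewrite ler_nat.
  have xk : box k%:R x.
    move=> i; have := rV_norm_le x (ler0n R k).
    by rewrite (le_trans _ hk') ?lerDl// => /esym/forallP.
  rewrite /v indicE mem_set// mulr1 min_l// (le_trans _ hk')// lerDr//.
have near1 : \forall k \near \oo, (d < choquard alpha (v k))%E.
  apply: lt_limn_einf; apply: (lt_le_trans du).
  have -> : choquard alpha u = choquard alpha (fun x => `|u x|).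
    pose D (w : E -> R) := (\int[mu]_x (convolution (riesz alpha) w x * (w x)%:E))%E.
    have DE f : choquard alpha f = D (fun x => `|f x| `^ (alpha / N%:R + 1)) by [].
    by rewrite !DE; congr D; apply/funext => x; rewrite normr_id.
  apply: choquard_fatou => //; first exact: measurableT_comp.
  exact: nearW.
have [k dk] := filter_ex near1.
exists (v k); split => //; apply: le_lt_trans uc.
apply: ge0_le_integral => //.
- by apply/measurable_EFinP/measurable_funX/measurableT_comp.
- by apply/measurable_EFinP/measurable_funX/measurableT_comp.
move=> x _; have /andP[v0 vm] := vb k x.
by rewrite lee_fin lerXn2r ?nnegrE// ger0_norm// (le_trans vm)// ge_min lexx.
Qed.

End approximation.

Section nice_functions.
Context {R : realType} {N : nat}.
Local Notation E := 'rV[R]_N.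
Local Notation mu := (lebesgueN R N).

Lemma nice_H1_grad (v : E -> R) (g : E -> E) : nice v g -> H1_grad v g.
Proof.
move=> [bv bg wg]; split; first exact: bcs_L2.
  by move=> i; exact: bcs_L2.
move=> phi i /test_function_C1 cphi.
by rewrite /Rintegral (wg i phi cphi) fineN.
Qed.

Lemma bcs_integralD (f g : E -> R) : bcs f -> bcs g ->
  (\int[mu]_x (f x + g x)%:E = \int[mu]_x (f x)%:E + \int[mu]_x (g x)%:E)%E.
Proof. by move=> bf bg; rewrite integralD_EFin//; exact: bcs_integrable. Qed.

Lemma bcs_integral_fin_num (f : E -> R) : bcs f -> (\int[mu]_x (f x)%:E)%E \is a fin_num.
Proof. by move=> bf; apply: integrable_fin_num => //; exact: bcs_integrable. Qed.

Lemma nice_lincomb (a : R) (v w : E -> R) (g k : E -> E) : nice v g -> nice w k ->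
  nice (fun x => a * v x + w x) (fun x => a *: g x + k x).
Proof.
move=> [bv bg vg] [bw bk wk]; split.
- by apply: bcsD => //; exact: bcsZ.
- move=> i; have := bcsD (bcsZ a (bg i)) (bk i); congr bcs.
  by apply/funext => x; rewrite !mxE.
move=> i phi cphi.
have lphi := C1_locally_bounded cphi.
have ldphi := C1_derive_locally_bounded i cphi.
have key (f f' psi : E -> R) : bcs f -> bcs f' -> locally_bounded_mfun psi ->
    (\int[mu]_x ((a * f x + f' x) * psi x)%:E =
     a%:E * \int[mu]_x (f x * psi x)%:E + \int[mu]_x (f' x * psi x)%:E)%E.
  move=> bf bf' lpsi.
  rewrite -bcs_integralZl; last exact: bcsM.
  rewrite -bcs_integralD; [|exact/bcsZ/bcsM|exact: bcsM].
  by apply: eq_integral => x _; rewrite mulrDl mulrA.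
rewrite key// (vg i _ cphi) (wk i _ cphi).
transitivity (- (\int[mu]_x ((a * g x 0%R i + k x 0%R i) * phi x)%:E))%E; last first.
  by congr (- _)%E; apply: eq_integral => x _; rewrite !mxE.
rewrite key//; have := bcs_integral_fin_num (bcsM (bk i) lphi).
move: (\int[mu]_x (g x 0%R i * phi x)%:E)%E (\int[mu]_x (k x 0%R i * phi x)%:E)%E => A B finB.
by rewrite (fin_num_oppeD _ finB) muleN.
Qed.

Lemma nice0 : nice (cst 0 : E -> R) (cst 0).
Proof.
split => [|i|i phi cphi]; first exact: bcs0.
  by have := @bcs0 R N; congr bcs; apply/funext => x; rewrite mxE.
rewrite integral0_eq; last by move=> x _; rewrite mul0r.
by rewrite integral0_eq ?oppe0// => x _; rewrite mxE mul0r.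
Qed.

Lemma bcs_integral_affine (s : R) (b : E) (f : E -> R) : 0 < s -> bcs f ->
  (\int[mu]_x (f (s *: x + b)%R)%:E = ((s ^+ N)^-1)%:E * \int[mu]_x (f x)%:E)%E.
Proof.
move=> s0 bf.
have mf : measurable_fun [set: E] (EFin \o f) by apply/measurable_EFinP; case: bf.
rewrite integralE [in RHS]integralE muleBr//; last first.
  rewrite fin_num_adde_defr//; apply: integrable_pos_fin_num => //.
  exact: bcs_integrable.
congr (_ - _)%E.
- rewrite -(ge0_integral_affineV b s0 (measurable_funepos mf))//.
  by apply: eq_integral => x _; rewrite !funeposE.
- rewrite -(ge0_integral_affineV b s0 (measurable_funeneg mf))//.
  by apply: eq_integral => x _; rewrite !funenegE.
Qed.

Lemma nice_affine (a s : R) (b : E) (v : E -> R) (g : E -> E) : 0 < s -> nice v g ->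
  nice (fun x => a * v (s *: x + b)) (fun x => (a * s) *: g (s *: x + b)).
Proof.
move=> s0 [bv bg vg].
have sN0 : s != 0 by rewrite gt_eqF.
split.
- by apply: bcsZ; exact: bcs_affine.
- move=> i; have := bcsZ (a * s) (bcs_affine b sN0 (bg i)); congr bcs.
  by apply/funext => x; rewrite !mxE.
move=> i phi cphi.
(* The test function is transported by the inverse affine map, so that the weak derivative of [v]
   itself can be used. *)
pose psi y := phi (s^-1 *: y + (- s^-1) *: b).
have cpsi : C1 psi by exact: C1_affine.
have psiE x : psi (s *: x + b) = phi x.
  by rewrite /psi scalerDr scalerA mulVf// scale1r scaleNr addrK.
have dpsiE x : 'D_(Defs.basis i) phi x = s * 'D_(Defs.basis i) psi (s *: x + b).
  have [_ dp _] := cphi.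
  rewrite /psi (derive_affine s^-1 ((- s^-1) *: b) (s *: x + b) (dp i)).2.
  rewrite mulrA mulfV// mul1r; congr ('D__ _ _).
  by rewrite scalerDr scalerA mulVf// scale1r scaleNr addrK.
have lpsi := C1_locally_bounded cpsi.
have ldpsi := C1_derive_locally_bounded i cpsi.
transitivity (\int[mu]_x (a * s * (v (s *: x + b) * 'D_(Defs.basis i) psi (s *: x + b)))%:E)%E.
  by apply: eq_integral => x _; rewrite dpsiE mulrACA.
transitivity (- \int[mu]_x (a * s * (g (s *: x + b)%R 0%R i * psi (s *: x + b)%R))%:E)%E; last first.
  by congr (- _)%E; apply: eq_integral => x _; rewrite psiE mxE !mulrA.
have bvp : bcs (fun x => v x * 'D_(Defs.basis i) psi x) by exact: bcsM.
have bgp : bcs (fun x => g x 0 i * psi x) by exact: bcsM.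
rewrite (bcs_integralZl _ (bcs_affine b sN0 bvp)) (bcs_integralZl _ (bcs_affine b sN0 bgp)).
rewrite (bcs_integral_affine b s0 bvp) (bcs_integral_affine b s0 bgp).
by rewrite (vg i psi cpsi) !muleN.
Qed.

End nice_functions.

Section near_minimizers.
Context {R : realType} {N : nat}.
Local Notation E := 'rV[R]_N.
Local Notation mu := (lebesgueN R N).

Lemma enorm_sqr (x : E) : enorm x ^+ 2 = \sum_i x 0 i ^+ 2.
Proof. by rewrite sqr_sqrtr// sumr_ge0// => i _; exact: sqr_ge0. Qed.

Lemma bcs_sum (I : Type) (s : seq I) (f : I -> E -> R) : (forall i, bcs (f i)) ->
  bcs (fun x => \sum_(i <- s) f i x).
Proof.
move=> bf; elim: s => [|i s IH].
  by have := @bcs0 R N; congr bcs; apply/funext => x; rewrite big_nil.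
by have := bcsD (bf i) IH; congr bcs; apply/funext => x; rewrite big_cons.
Qed.

Lemma bcs_enorm_sqr (g : E -> E) : (forall i, bcs (fun x => g x 0 i)) ->
  bcs (fun x => enorm (g x) ^+ 2).
Proof.
move=> bg; have := bcs_sum (index_enum 'I_N) (fun i => bcs_sqr (bg i)).
congr bcs; apply/funext => x; rewrite enorm_sqr; apply: eq_bigr => i _.
by rewrite -normrX ger0_norm// sqr_ge0.
Qed.

Definition gradsq (g : E -> E) : \bar R := (\int[mu]_x (enorm (g x) ^+ 2)%:E)%E.

Lemma gradsq_affine (a s : R) (b : E) (g : E -> E) : 0 < s ->
  (forall i, bcs (fun x => g x 0%R i)) ->
  (gradsq (fun x => a *: g (s *: x + b)%R) = (a ^+ 2 / s ^+ N)%:E * gradsq g)%E.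
Proof.
move=> s0 bg; have b2 := bcs_enorm_sqr bg.
rewrite /gradsq EFinM -muleA -(bcs_integral_affine b s0 b2).
rewrite -bcs_integralZl; last exact: (bcs_affine b (lt0r_neq0 s0) b2).
apply: eq_integral => x _; rewrite !enorm_sqr mulr_sumr; congr EFin.
by apply: eq_bigr => i _; rewrite mxE exprMn.
Qed.

Lemma sqnorm_affine (a s : R) (b : E) (v : E -> R) : 0 < s -> bcs v ->
  (sqnorm (fun x => a * v (s *: x + b))%R = (a ^+ 2 / s ^+ N)%:E * sqnorm v)%E.
Proof.
move=> s0 bv; have b2 := bcs_sqr bv.
rewrite /sqnorm EFinM -muleA -(bcs_integral_affine b s0 b2).
rewrite -bcs_integralZl; last exact: (bcs_affine b (lt0r_neq0 s0) b2).
apply: eq_integral => x _; rewrite normrM exprMn; congr (_ * _)%:E.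
by rewrite -normrX ger0_norm// sqr_ge0.
Qed.

Lemma sqnorm_ge0 (v : E -> R) : (0 <= sqnorm v)%E.
Proof. by apply: integral_ge0 => x _; rewrite lee_fin exprn_ge0. Qed.

Lemma gradsq_ge0 (g : E -> E) : (0 <= gradsq g)%E.
Proof. by apply: integral_ge0 => x _; rewrite lee_fin exprn_ge0// enorm_ge0. Qed.

(** [V] may be negative: passing to the positive part of the integrand reduces the claim to
    monotonicity for nonnegative functions, and [0 <= k] keeps the upper bound nonnegative. *)
Lemma energy_le (V : E -> R) (v : E -> R) (g : E -> E) (k : R) : 0 <= k ->
  measurable_fun [set: E] V -> bcs v -> (forall i, bcs (fun x => g x 0%R i)) ->
  {ae mu, forall x, v x != 0 -> V x <= k} ->
  (energy V v g <= gradsq g + k%:E * sqnorm v)%E.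
Proof.
move=> k0 mV bv bg Vk.
have b1 := bcs_enorm_sqr bg; have b2 := bcs_sqr bv.
pose F x := (enorm (g x) ^+ 2 + V x * `|v x| ^+ 2)%:E.
have mF : measurable_fun [set: E] F.
  apply/measurable_EFinP/measurable_funD; first exact: bcs_measurable b1.
  by apply: measurable_funM => //; exact: bcs_measurable b2.
apply: (@le_trans _ _ (\int[mu]_x F^\+ x)%E).
  rewrite /energy integralE -[leRHS]adde0; apply: leeD => //.
  by rewrite oppe_le0 integral_ge0.
rewrite -bcs_integralZl// -bcs_integralD//; last exact: bcsZ.
apply: ae_ge0_le_integral => //.
- exact: measurable_funepos.
- by move=> x _; rewrite lee_fin addr_ge0// ?exprn_ge0 ?enorm_ge0// mulr_ge0// exprn_ge0.
- by apply/measurable_EFinP; apply: bcs_measurable; apply: bcsD => //; exact: bcsZ.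
apply: filterS Vk => x Vk _.
rewrite funeposE ge_max; apply/andP; split; rewrite lee_fin; last first.
  by rewrite addr_ge0// ?exprn_ge0 ?enorm_ge0// mulr_ge0// exprn_ge0.
rewrite lerD2l; have [->|v0] := eqVneq (v x) 0.
  by rewrite normr0 expr0n !mulr0.
by rewrite ler_wpM2r ?exprn_ge0// Vk.
Qed.

Lemma energy_cst1 (v : E -> R) (g : E -> E) :
  bcs v -> (forall i, bcs (fun x => g x 0%R i)) ->
  energy (cst 1) v g = (gradsq g + sqnorm v)%E.
Proof.
move=> bv bg; have b1 := bcs_enorm_sqr bg; have b2 := bcs_sqr bv.
by rewrite -bcs_integralD//; apply: eq_integral => x _; rewrite mul1r.
Qed.

Lemma ess_limsup_infty_bound (V : E -> R) (e : R) : 0 < e -> (ess_limsup_infty V <= 1)%E ->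
  exists r : R, {ae mu, forall x, r < enorm x -> V x <= 1 + e}.
Proof.
move=> e0 V1.
have /ereal_inf_lt[_ [r _ <-] hr] : (ess_limsup_infty V < (1 + e)%:E)%E.
  by apply: le_lt_trans V1 _; rewrite lte_fin ltrDl.
exists r; have := @ess_sup_ge _ _ _ mu (fun x => if r < enorm x then (V x)%:E else -oo%E).
apply: filterS => x hx rx; rewrite rx in hx.
by have := le_trans hx (ltW hr); rewrite lee_fin.
Qed.

End near_minimizers.

Section far_minimizers.
Context {R : realType} {N : nat}.
Local Notation E := 'rV[R]_N.
Local Notation mu := (lebesgueN R N).
Variables (alpha : R).
Hypotheses (N_ge1 : (1 <= N)%N) (alpha_gt0 : 0 < alpha) (alpha_ltN : alpha < N%:R).

Let N0 : 0 < N%:R :> R. Proof. by rewrite ltr0n. Qed.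
Local Notation p := (alpha / N%:R + 1).
Let p1 : 1 <= p. Proof. by rewrite lerDr divr_ge0// ltW. Qed.
Let p0 : 0 < p. Proof. exact: lt_le_trans p1. Qed.

Lemma choquard_scale (a : R) (v : E -> R) : 0 <= a -> measurable_fun [set: E] v ->
  choquard alpha (fun x => a * v x) = (((a `^ p) ^+ 2)%:E * choquard alpha v)%E.
Proof.
move=> a0 mv.
have -> : (fun x => a * v x) = (fun x => a * v (1 *: x + 0)).
  by apply/funext => x; rewrite (scale1r x) (addr0 x).
rewrite choquard_affine//; congr (_%:E * _)%E.
by rewrite powR1 expr1n mulr1 expr1n divr1.
Qed.

Lemma sqnorm_scale (a : R) (v : E -> R) : bcs v ->
  (sqnorm (fun x => a * v x)%R = (a ^+ 2)%:E * sqnorm v)%E.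
Proof.
move=> bv.
have -> : (fun x => a * v x) = (fun x => a * v (1 *: x + 0)).
  by apply/funext => x; rewrite (scale1r x) (addr0 x).
by rewrite sqnorm_affine// expr1n divr1.
Qed.

Lemma choquard_fin_num (v : E -> R) : bcs v -> choquard alpha v \is a fin_num.
Proof. by move=> bv; rewrite ge0_fin_numE ?choquard_ge0// choquard_lty. Qed.

(** The exponent is dictated by the homogeneity of degree [2 * p]. *)
Lemma choquard_normalize (v : E -> R) (D : R) : bcs v -> choquard alpha v = D%:E -> 0 < D ->
  choquard alpha (fun x => D `^ (- (2 * p)^-1) * v x) = 1%E.
Proof.
move=> bv vD D0; rewrite choquard_scale ?powR_ge0//; last exact: bcs_measurable.
have -> : ((D `^ (- (2 * p)^-1)) `^ p) ^+ 2 = D `^ (- 1).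
  rewrite -powR_mulrn ?powR_ge0// -!powRrM; congr (_ `^ _).
  by move: p p0 => q q0; field; rewrite gt_eqF.
by rewrite vD -EFinM powR_inv1 ?(ltW D0)// mulVf// gt_eqF.
Qed.

Lemma c_infty_ge0 : (0 <= c_infty N alpha :> \bar R)%E.
Proof.
by apply: le_ereal_inf_tmp => _ [u [_ _ ->]]; exact: sqnorm_ge0.
Qed.

(** The normalized indicator of [box 1] is a competitor of finite norm; from here on the infimum can
    be handled as a real number. *)
Lemma c_infty_fin_num : c_infty N alpha \is a @fin_num R.
Proof.
rewrite ge0_fin_numE ?c_infty_ge0//.
have b1 := @bcs_indic_box R N 1.
have /fineK D1 := choquard_fin_num b1.
have D0 : 0 < fine (choquard alpha (\1_(box 1) : E -> R)).
  by rewrite -lte_fin D1 choquard_indic_box_gt0.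
have bv := bcsZ (fine (choquard alpha (\1_(box 1) : E -> R)) `^ (- (2 * p)^-1)) b1.
apply: (@le_lt_trans _ _ (sqnorm (fun x => fine (choquard alpha (\1_(box 1) : E -> R)) `^ (- (2 * p)^-1) * \1_(box 1) x)%R)).
  apply: ereal_inf_lbound; eexists; split; [exact: bcs_L2 bv| |by []].
  exact: choquard_normalize (esym D1) D0.
by rewrite -ge0_fin_numE ?sqnorm_ge0//; exact: bcs_integral_fin_num (bcs_sqr bv).
Qed.

Local Notation c := (fine (c_infty N alpha : \bar R)).

Let c_ge0 : 0 <= c. Proof. by rewrite fine_ge0// c_infty_ge0. Qed.

Lemma nice_near_minimizer (eta : R) : 0 < eta ->
  exists (v : E -> R) (g : E -> E), [/\ nice v g, choquard alpha v = 1%E & (sqnorm v <= (c + eta)%:E)%E].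
Proof.
move=> eta0.
(* This [e] solves [(c + e) / (1 - e) = c + eta], the loss caused by approximation and normalization
   together. *)
pose e := eta / (1 + c + eta).
have d0 : 0 < 1 + c + eta by rewrite ltr_pwDr// addr_ge0.
have e0 : 0 < e by exact: divr_gt0.
have e1 : e < 1 by rewrite ltr_pdivrMr// mul1r ltrDr ltr_pwDl.
have [_ [u [L2u Du ->]] uc] := lb_ereal_inf_adherent e0 c_infty_fin_num.
have [||v [bv dv vc]] := @truncation_approx R N alpha alpha_gt0 alpha_ltN u (1 - e)%:E (c + e)%:E (L2_measurable L2u).
- by rewrite Du lte_fin gtrBl.
- by rewrite EFinD fineK// c_infty_fin_num.
have [w [g [nw dw wc]]] := nice_approx alpha_gt0 alpha_ltN bv dv vc.
have [bw _ _] := nw.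
have /fineK Dw := choquard_fin_num bw.
set D := fine (choquard alpha w) in Dw.
have De : 1 - e < D by rewrite -lte_fin Dw.
have D0 : 0 < D by apply: lt_trans De; rewrite subr_gt0.
pose t := D `^ (- (2 * p)^-1).
have t0 : 0 <= t by exact: powR_ge0.
have t2 : t ^+ 2 <= (1 - e)^-1.
  have -> : t ^+ 2 = D `^ (- p^-1).
    rewrite /t -powR_mulrn ?powR_ge0// -powRrM; congr (_ `^ _).
    by move: p p0 => q q0; field; rewrite gt_eqF.
  apply: (@le_trans _ _ ((1 - e) `^ (- p^-1))).
    rewrite !powRN lef_pV2 ?posrE ?powR_gt0 ?subr_gt0//.
    by apply: ge0_ler_powR; rewrite ?invr_ge0 ?(ltW p0)// ?nnegrE ?subr_ge0 ltW.
  rewrite -[leRHS]powR_inv1 ?subr_ge0 ?(ltW e1)//.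
  apply: ger_powR; first by rewrite subr_gt0 e1/= gerBl ltW.
  by rewrite lerN2 invf_le1.
have nt := nice_lincomb t nw (@nice0 R N).
have tE : (fun x => t * w x + (cst 0 : E -> R) x) = (fun x => t * w x).
  by apply/funext => x; rewrite addr0.
exists (fun x => t * w x), (fun x => t *: g x + cst 0 x); split.
- by rewrite -tE.
- exact: choquard_normalize (esym Dw) D0.
rewrite sqnorm_scale//.
apply: (@le_trans _ _ ((1 - e)^-1%:E * (c + e)%:E)%E).
  by apply: lee_pmul; rewrite ?lee_fin ?exprn_ge0 ?sqnorm_ge0// ltW.
rewrite -EFinM lee_fin ler_pdivrMl ?subr_gt0//.
have ee : e * (1 + c + eta) = eta by rewrite /e divfK ?gt_eqF.
have -> : (1 - e) * (c + eta) = c + (eta - e * (1 + c + eta)) + e by ring.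
by rewrite ee subrr addr0.
Qed.

End far_minimizers.

Section far_minimizers.
Context {R : realType} {N : nat}.
Local Notation E := 'rV[R]_N.
Local Notation mu := (lebesgueN R N).
Variables (alpha : R).
Hypotheses (N_ge1 : (1 <= N)%N) (alpha_gt0 : 0 < alpha) (alpha_ltN : alpha < N%:R).
Local Notation c := (fine (c_infty N alpha : \bar R)).

Let N0 : 0 < N%:R :> R. Proof. by rewrite ltr0n. Qed.
Let c_ge0 : 0 <= c. Proof. by rewrite fine_ge0// c_infty_ge0. Qed.

Lemma nice_small_gradient (eta : R) : 0 < eta ->
  exists (v : E -> R) (g : E -> E), [/\ nice v g, choquard alpha v = 1%E,
    (sqnorm v <= (c + eta)%:E)%E & (gradsq g <= eta%:E)%E].
Proof.
move=> eta0.
have [v [g [nv dv vc]]] := nice_near_minimizer N_ge1 alpha_gt0 alpha_ltN eta0.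
have [bv bg _] := nv.
have /fineK gE := bcs_integral_fin_num (bcs_enorm_sqr bg).
set G := fine _ in gE.
have G0 : 0 <= G by rewrite fine_ge0// gradsq_ge0.
(* The dilated gradient term is [t ^+ 2 * G <= t * G <= eta]; [G + 1] avoids a division by 0. *)
pose t := Num.min 1 (eta / (G + 1)).
have G1 : 0 < G + 1 by rewrite ltr_wpDl.
have t0 : 0 < t by rewrite lt_min ltr01 divr_gt0.
have t1 : t <= 1 by rewrite ge_min lexx.
have tG : t * G <= eta.
  apply: (@le_trans _ _ (t * (G + 1))); first by rewrite ler_pM2l// lerDl.
  by rewrite -ler_pdivlMr// ge_min lexx orbT.
pose a := t `^ (N%:R / 2).
have a2 : a ^+ 2 = t ^+ N.
  rewrite -powR_mulrn ?powR_ge0// -powRrM -[t ^+ N]powR_mulrn ?(ltW t0)//.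
  by congr (_ `^ _); rewrite divfK.
exists (fun x => a * v (t *: x + 0)), (fun x => (a * t) *: g (t *: x + 0)); split.
- exact: nice_affine.
- rewrite choquard_affine ?powR_ge0 ?dv ?mule1//; last exact: bcs_measurable.
  congr EFin; have tN : t ^+ N != 0 by rewrite expf_neq0// gt_eqF.
  rewrite -[(a `^ _) ^+ 2]powR_mulrn ?powR_ge0// -!powRrM -powRD; last first.
    by rewrite (gt_eqF t0) implybT.
  rewrite -exprM -[t ^+ (_ * _)]powR_mulrn ?(ltW t0)//.
  (* Scale invariance of the Choquard term: the weights contribute [N + alpha], the kernel
     [N - alpha], and the two integrations remove [2 * N]. *)
  rewrite (_ : N%:R / 2 * ((alpha / N%:R + 1) * 2) + (N%:R - alpha) = (N * 2)%:R).
    by rewrite mulfV// powR_eq0 (gt_eqF t0).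
  by rewrite natrM; move: N0; move: N%:R => n n0; field; rewrite gt_eqF.
- by rewrite sqnorm_affine// a2 mulfV ?expf_neq0 ?gt_eqF// mul1e.
rewrite gradsq_affine// exprMn a2 mulrAC mulfV ?expf_neq0 ?gt_eqF// mul1r.
rewrite /gradsq -gE -EFinM lee_fin (le_trans _ tG)// expr2 -mulrA ler_piMl//.
by rewrite mulr_ge0// ltW.
Qed.

(** The freedom in [b] allows supports to be separated later. The energy for [V] serves the infimum
    [c_star], the one for [cst 1] bounds the H^1 norm. *)
Lemma far_minimizer (i0 : 'I_N) (V : E -> R) (e : R) : measurable_fun [set: E] V ->
  (ess_limsup_infty V <= 1)%E -> 0 < e ->
  exists2 T : R, 0 < T & forall b : R, T <= b -> exists (v : E -> R) (g : E -> E),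
    [/\ nice v g, choquard alpha v = 1%E,
      (energy V v g <= (e + (1 + e) * (c + e))%:E)%E,
      (energy (cst 1%R) v g <= (c + 2 * e)%:E)%E &
      forall x, v x != 0 \/ g x != 0 -> `|x 0 i0 - b| < T].
Proof.
move=> mV V1 e0.
have [v [g [nv dv vc gc]]] := nice_small_gradient e0.
have [bv bg _] := nv.
have [rho hrho] := ess_limsup_infty_bound e0 V1.
(* A sum of squares vanishes only where both terms do, so one box contains the supports of [v] and
   [g]. *)
have [_ [B hB]] := bcsD (bcs_sqr bv) (bcs_enorm_sqr bg).
have supp x : v x != 0 \/ g x != 0 -> box B x.
  move=> vg; apply: hB.2; apply/negP => /eqP/eqP.
  rewrite paddr_eq0 ?exprn_ge0 ?enorm_ge0// => /andP[].
  rewrite sqrf_eq0 normr_eq0 => /eqP v0; rewrite enorm_sqr psumr_eq0; last first.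
    by move=> i _; exact: sqr_ge0.
  move=> /allP g0; case: vg => [|/eqP]; first by rewrite v0 eqxx.
  apply; apply/rowP => i; rewrite mxE; apply/eqP.
  by have := g0 i; rewrite mem_index_enum sqrf_eq0 => /(_ isT).
(* On the translated support [x 0 i0 >= b - B > rho], hence [rho < enorm x] and [V x <= 1 + e]
   almost everywhere there; the 1 makes the inequalities strict. *)
exists (`|B| + `|rho| + 1) => [|b hb]; first by rewrite ltr_wpDl ?addr_ge0.
pose s := (- b) *: Defs.basis i0 : E.
pose v' x := 1 * v (1 *: x + s); pose g' x := (1 * 1) *: g (1 *: x + s).
have nv' : nice v' g' by exact: nice_affine.
have [bv' bg' _] := nv'.
have supp' x : v' x != 0 \/ g' x != 0 -> `|x 0 i0 - b| <= B.
  rewrite /v' /g' mulr1 mul1r !scale1r => /supp bx; have := bx i0.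
  by rewrite !mxE/= !eqxx mulr1.
have sq' : (sqnorm v' <= (c + e)%:E)%E.
  by rewrite sqnorm_affine// expr1n expr1n divr1 mul1e.
have gr' : (gradsq g' <= e%:E)%E.
  by rewrite gradsq_affine// mulr1 expr1n expr1n divr1 mul1e.
exists v', g'; split; first exact: nv'.
- rewrite choquard_affine ?dv//; last exact: bcs_measurable.
  by rewrite mule1 !powR1 !expr1n divr1 mulr1.
- have e1 : 0 <= 1 + e by rewrite addr_ge0// ltW.
  apply: le_trans (@energy_le _ _ V v' g' (1 + e) e1 mV bv' bg' _) _.
    apply: filterS hrho => x hx vx; apply: hx.
    apply: lt_le_trans (coord_le_enorm x i0).
    have := supp' x (or_introl vx); move: (x 0 i0) => y.
    have := ler_norm B; have := ler_norm rho; have := ler_norm y.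
    have := ler_norm (b - y); rewrite distrC; have := normr_ge0 rho.
    by clear -hb; move: (`|B|) (`|rho|) (`|y|) (`|y - b|) hb => *; lra.
  rewrite [leRHS]EFinD EFinM; apply: leeD => //.
  by apply: lee_pmul; rewrite ?sqnorm_ge0 ?lee_fin.
- rewrite energy_cst1// (le_trans (leeD gr' sq'))// -EFinD lee_fin.
  by rewrite le_eqVlt; apply/orP; left; apply/eqP; ring.
move=> x /supp' h; apply: (le_lt_trans h).
by rewrite (le_lt_trans (ler_norm B))// ltr_pwDr// lerDl.
Qed.

End far_minimizers.

(** * Weak convergence *)

Section disjoint_supports.
Context {R : realType} {N : nat}.
Local Notation E := 'rV[R]_N.

(** The gradient is required to vanish too, as [g] is a mere representative and its pointwise values
    are not determined by [v]. *)
Definition vanish (v : E -> R) (g : E -> E) (x : E) := v x = 0 /\ g x = 0.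

Lemma energy_disjoint (a : R) (v w : E -> R) (g k : E -> E) : nice v g -> nice w k ->
  (forall x, vanish v g x \/ vanish w k x) ->
  energy (cst 1) (fun x => a * v x + w x) (fun x => a *: g x + k x) =
  ((a ^+ 2)%:E * energy (cst 1%R) v g + energy (cst 1%R) w k)%E.
Proof.
move=> nv nw vw; have [bv bg _] := nv; have [bw bk _] := nw.
have bE (f : E -> R) (h : E -> E) : nice f h -> bcs (fun x => enorm (h x) ^+ 2 + 1 * `|f x| ^+ 2).
  by move=> [bf bh _]; apply: bcsD; [exact: bcs_enorm_sqr|exact/bcsZ/bcs_sqr].
rewrite /energy -bcs_integralZl; last exact: bE.
rewrite -bcs_integralD; [|exact/bcsZ/bE|exact: bE].
have e0 : enorm (0 : E) = 0.
  by rewrite -(scale0r (0 : E)) enormZ// mul0r.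
apply: eq_integral => x _; congr EFin => /=; have [[-> ->]|[-> ->]] := vw x.
  by rewrite e0 normr0 expr0n/= !(mulr0, scaler0, add0r, addr0).
rewrite e0 normr0 expr0n/= !(mulr0, addr0) !enorm_sqr !mul1r normrM exprMn.
rewrite mulrDr -[`|a| ^+ 2]normrX (ger0_norm (sqr_ge0 a)); congr (_ + _).
by rewrite mulr_sumr; apply: eq_bigr => i _; rewrite mxE exprMn.
Qed.

(* Bessel's inequality for the pairwise orthogonal functions [v n]: testing [l]
   on the finite sums of [l (v n) *: v n] bounds the sum of the [l (v n) ^+ 2]. *)
Lemma disjoint_weak_cvg (v : nat -> E -> R) (g : nat -> E -> E) (K : R) :
  (forall n, nice (v n) (g n)) ->
  (forall n, (energy (cst 1%R) (v n) (g n) <= K%:E)%E) ->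
  (forall n m x, (n < m)%N -> vanish (v n) (g n) x \/ vanish (v m) (g m) x) ->
  H1_weak_cvg v (cst 0).
Proof.
move=> nv vK dis l [ll [C lC]].
have nH (w : E -> R) (k : E -> E) (nw : nice w k) : H1 w by exists k; exact: nice_H1_grad.
have l0 : l (cst 0) = 0.
  have := ll (-1) _ _ (nH _ _ (@nice0 R N)) (nH _ _ (@nice0 R N)).
  have -> : (fun x => -1 * (cst 0 : E -> R) x + (cst 0 : E -> R) x) = cst 0.
    by apply/funext => x; rewrite mulr0 addr0.
  by move=> ->; rewrite mulN1r addNr.
rewrite l0; pose a n := l (v n).
pose S m (x : E) := \sum_(n < m) a n * v n x.
pose G m (x : E) := \sum_(n < m) a n *: g n x.
pose T m := \sum_(0 <= n < m) a n ^+ 2.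
have TS m : T m.+1 = a m ^+ 2 + T m by rewrite /T big_nat_recr//= addrC.
have SS m : S m.+1 = (fun x => a m * v m x + S m x).
  by apply/funext => x; rewrite /S big_ord_recr/= addrC.
have GS m : G m.+1 = (fun x => a m *: g m x + G m x).
  by apply/funext => x; rewrite /G big_ord_recr/= addrC.
have S0 : S 0 = cst 0 by apply/funext => x; rewrite /S big_ord0.
have G0 : G 0 = cst 0 by apply/funext => x; rewrite /G big_ord0.
have nS m : nice (S m) (G m).
  elim: m => [|m IH]; first by rewrite S0 G0; exact: nice0.
  by rewrite SS GS; exact: nice_lincomb.
have lS m : l (S m) = T m.
  elim: m => [|m IH]; first by rewrite S0 l0 /T big_geq.
  by rewrite SS ll ?IH ?TS ?expr2//; [exact: nH _ _ (nv m)|exact: nH _ _ (nS m)].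
have ES m : (energy (cst 1%R) (S m) (G m) <= (T m * K)%:E)%E.
  elim: m => [|m IH].
    rewrite S0 G0 /T big_geq// mul0r energy_cst1; [|exact: bcs0|by case: (@nice0 R N)].
    rewrite /gradsq /sqnorm !integral0_eq ?adde0// => x _.
      by rewrite normr0 expr0n.
    by rewrite enorm_sqr big1// => i _; rewrite mxE expr0n.
  rewrite SS GS energy_disjoint//; last first.
    move=> x; have [vm|nvm] := pselect (vanish (v m) (g m) x); first by left.
    right; split; rewrite /S /G big1// => i _; have [[vi gi]|//] := dis i m x (ltn_ord i).
      by rewrite vi mulr0.
    by rewrite gi scaler0.
  rewrite TS mulrDl EFinD; apply: leeD => //.
  rewrite [leRHS]EFinM; apply: lee_pmul; rewrite ?lee_fin ?sqr_ge0//.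
  by have [bv bg _] := nv m; rewrite energy_cst1// adde_ge0 ?gradsq_ge0 ?sqnorm_ge0.
have Tge0 m : 0 <= T m by apply: sumr_ge0 => i _; exact: sqr_ge0.
have K0 : 0 <= K.
  rewrite -lee_fin; apply: le_trans (vK 0); case: (nv 0) => bv bg _.
  by rewrite energy_cst1// adde_ge0 ?gradsq_ge0 ?sqnorm_ge0.
(* Since [l (S m) = T m], boundedness of [l] gives [T m <= |C| * sqrt (T m * K)]; squaring and
   dividing by [T m] gives the claim. [C] has no prescribed sign, hence the absolute value. *)
have Tbd m : T m <= C ^+ 2 * K.
  have [T0|T0] := eqVneq (T m) 0; first by rewrite T0 mulr_ge0 ?sqr_ge0.
  have Tp : 0 < T m by rewrite lt_neqAle eq_sym T0 Tge0.
  have := lC _ _ (nice_H1_grad (nS m)); rewrite lS ger0_norm// => h.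
  have fE : fine (energy (cst 1%R) (S m) (G m)) <= T m * K.
    have [bS bG _] := nS m.
    have f1 : energy (cst 1%R) (S m) (G m) \is a fin_num.
      rewrite energy_cst1// fin_numD; apply/andP; split.
        exact: bcs_integral_fin_num (bcs_enorm_sqr bG).
      exact: bcs_integral_fin_num (bcs_sqr bS).
    by rewrite -lee_fin fineK.
  have h2 : T m <= `|C| * Num.sqrt (T m * K).
    apply: (le_trans h); apply: (@le_trans _ _ (`|C| * Num.sqrt (fine (energy (cst 1) (S m) (G m))))).
      by rewrite ler_wpM2r ?sqrtr_ge0// ler_norm.
    by rewrite ler_wpM2l// ler_wsqrtr.
  have : T m ^+ 2 <= (`|C| * Num.sqrt (T m * K)) ^+ 2.
    by rewrite lerXn2r ?nnegrE// mulr_ge0 ?sqrtr_ge0.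
  rewrite exprMn sqr_sqrtr ?mulr_ge0// -normrX (ger0_norm (sqr_ge0 C)) expr2.
  by rewrite mulrCA ler_pM2l.
(* The partial sums [T m] increase and are bounded, so the series converges and its terms tend to
   0. *)
have a2 : (fun n => a n ^+ 2) @ \oo --> 0.
  apply: cvg_series_cvg_0; apply: nondecreasing_is_cvgn.
    by apply/nondecreasing_seqP => n; rewrite -[series _ n]/(T n) -[series _ n.+1]/(T n.+1) TS lerDr sqr_ge0.
  by exists (C ^+ 2 * K) => _ [n _ <-]; exact: Tbd.
apply: norm_cvg0.
have -> : (fun n => `|l (v n)|) = (fun n => Num.sqrt (a n ^+ 2)).
  by apply/funext => n; rewrite sqrtr_sqr.
rewrite -[X in _ --> X]sqrtr0.
by apply: continuous_cvg; [exact: sqrt_continuous|].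
Qed.

End disjoint_supports.

(** * The inequality and the weakly null minimizing sequence *)

Theorem proposition5 (R : realType) (N : nat) (N_ge1 : (1 <= N)%N)
    (alpha : R) (alpha_gt0 : 0 < alpha) (alpha_ltN : alpha < N%:R)
    (V : 'rV[R]_N -> R) (V_bounded : V \in Lfun (lebesgueN R N) +oo%E)
    (V_limsup : (ess_limsup_infty V <= 1)%E) :
  (c_star alpha V <= c_infty N alpha)%E /\
  (c_star alpha V = c_infty N alpha ->
   exists u : nat -> 'rV[R]_N -> R,
     minimizing_sequence alpha V u /\ H1_weak_cvg u (cst 0)).
Proof.
have mV : measurable_fun [set: 'rV[R]_N] V.
  by move/sub_Lfun_mfun: V_bounded; rewrite inE.
pose i0 : 'I_N := Ordinal N_ge1.
pose c : R := fine (c_infty N alpha).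
have cE : c_infty N alpha = c%:E by rewrite fineK// c_infty_fin_num.
pose e n : R := harmonic n.
have e0 n : 0 < e n by exact: harmonic_gt0.
have e1 n : e n <= 1 by rewrite invf_le1 ?ltr0n// ler1n.
have ecvg : e @ \oo --> 0 by exact: cvg_harmonic.
have /choice[T HT] : forall n, exists T : R, 0 < T /\ forall b : R, T <= b ->
    exists v : 'rV[R]_N -> R, exists g : 'rV[R]_N -> 'rV[R]_N,
    [/\ nice v g, choquard alpha v = 1%E,
      (energy V v g <= (e n + (1 + e n) * (c + e n))%:E)%E,
      (energy (cst 1%R) v g <= (c + 2 * e n)%:E)%E &
      forall x, v x != 0 \/ g x != 0 -> `|x 0%R i0 - b| < T].
  move=> n.
  have [T T0 hT] := far_minimizer N_ge1 alpha_gt0 alpha_ltN i0 mV V_limsup (e0 n).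
  by exists T.
pose S n := \sum_(0 <= k < n) T k.
have SS n : S n.+1 = S n + T n by rewrite /S big_nat_recr.
have S_ge0 n : 0 <= S n by apply: sumr_ge0 => k _; rewrite ltW// (HT k).1.
have S_le n m : (n <= m)%N -> S n <= S m.
  by apply: (homo_leq lexx le_trans) => k; rewrite SS lerDl ltW// (HT k).1.
(* The support of the n-th function, of half-width [T n] around [b n], lies in the slab from
   [2 * S n] to [2 * S n.+1]; consecutive slabs are disjoint. *)
pose b n := 2 * S n + T n.
have bT n : T n <= b n by rewrite lerDr mulr_ge0.
have /choice[v /choice[g vg]] := fun n => (HT n).2 (b n) (bT n).
have vanishT n (x : 'rV[R]_N) : ~ (2 * S n < x 0 i0 < 2 * S n.+1) -> vanish (v n) (g n) x.
  move=> h; have [_ _ _ _ supp] := vg n.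
  have h' : ~ (v n x != 0 \/ g n x != 0).
    move=> /supp; rewrite ltr_distlC => hx; apply: h.
    by rewrite SS; move: hx; rewrite /b => /andP[]; move: (S n) (T n) (x 0 i0) => *; apply/andP; split; lra.
  by split; apply/eqP; apply: contrapT => /negP hx; apply: h'; [left|right].
have dis n m (x : 'rV[R]_N) : (n < m)%N -> vanish (v n) (g n) x \/ vanish (v m) (g m) x.
  move=> nm; have [hx|hx] := pselect (2 * S n < x 0 i0 < 2 * S n.+1).
    right; apply: vanishT; move: hx => /andP[_ hx] /andP[hx' _].
    have := S_le _ _ nm; move: (S n.+1) (S m) (x 0 i0) hx hx' => *; lra.
  by left; apply: vanishT.
have cs n : (c_star alpha V <= energy V (v n) (g n))%E.
  have [nv dv _ _ _] := vg n.
  by apply: ereal_inf_lbound; exists (v n), (g n); split => //; exact: nice_H1_grad.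
have ub : (e n + (1 + e n) * (c + e n))%:E @[n --> \oo] --> c%:E.
  apply: cvg_EFin; first exact: nearW.
  rewrite [X in _ --> X](_ : c = 0 + (1 + 0) * (c + 0)); last by rewrite add0r !addr0 mul1r.
  by apply: cvgD => //; apply: cvgM; apply: cvgD => //; exact: cvg_cst.
have le_c : (c_star alpha V <= c%:E)%E.
  rewrite -(cvg_lim _ ub)//; apply: lime_ge; first by apply/cvg_ex; exists c%:E.
  by apply: nearW => n; have [_ _ en _ _] := vg n; exact: le_trans (cs n) en.
rewrite cE; split => // cs_eq; exists v; split.
  exists g; split => [n|n|].
  - by have [nv _ _ _ _] := vg n; exact: nice_H1_grad.
  - by have [_ dv _ _ _] := vg n.
  (* Each energy is at least [c_star], which here equals [c], and at most a quantity tending to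
     [c]. *)
  rewrite cs_eq; apply: (squeeze_cvge _ _ ub); last exact: cvg_cst.
  by apply: nearW => n; rewrite -cs_eq cs; have [_ _ en _ _] := vg n.
(* The uniform H^1 bound [c + 2] comes from [c + 2 * e n] and [e n <= 1]. *)
apply: (@disjoint_weak_cvg R N v g (c + 2)) => // n; first by have [] := vg n.
have [_ _ _ en _] := vg n; apply: (le_trans en).
by rewrite lee_fin lerD2l -[leRHS]mulr1 ler_pM2l.
Qed.
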